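(* Let $\mathsf{N}_n$ be a uniformly random simplex tree-child network with $n$ taxa. For every fixed $R\ge0$ and every finite rooted directed marked graph $G$, as $n\to\infty$, $$\frac{\#\{v\in V(\mathsf{N}_n):U_R(\mathsf{N}_n,v)\cong G\}}{|V(\mathsf{N}_n)|}\ \xrightarrow{p}\ \mathbb{P}\bigl(U_R(N^*,v^* )\cong G\bigr),$$ where $(N^*,v^* )$ is the random rooted network equal to $(\hat{\mathcal{L}},p_0)$ with probability $1/2$, to $(\hat{\mathcal{R}},\rho_0)$ with probability $1/4$, and to $(\hat{\mathsf{N}}^{\mathrm{lf}},\ell_0)$ with probability $1/4$.
   Context: A simplex tree-child network on a finite set $X$ is a finite directed acyclic graph $N=(V,E)$ with a root $o$ and with leaves bijectively labelled by $X$, such that: the root has (indegree, outdegree) $=(0,1)$; every vertex is reachable from $o$ by a directed path; every leaf has degree $(1,0)$; every vertex that is neither the root nor a leaf is either a tree vertex, of degree $(1,2)$, or a reticulation vertex, of degree $(2,1)$; (tree-child) every non-leaf vertex has at least one child that is a tree vertex or a leaf; (one-component) the unique child of every reticulation vertex is a leaf. Networks are considered up to isomorphism preserving leaf labels. $\mathsf{N}_n$ is uniform on the finite set of simplex tree-child networks with leaf label set $[n]$. Local neighbourhoods: for a directed graph $N$ and $v\in V(N)$, $U_R(N,v)$ is the subgraph induced by the vertices at undirected graph distance at most $R$ from $v$, rooted at $v$. Each vertex carries a mark giving its type in $N$ (root, tree vertex, reticulation, or leaf); leaf labels are ignored. $\cong$ denotes isomorphism of rooted directed marked graphs, i.e.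 a bijection of vertex sets preserving root, marks, edges and edge orientations. Limit networks (deterministic). A bi-infinite spine is a bi-infinite directed path $\cdots\to x_{-1}\to x_0\to x_1\to\cdots$ of tree vertices. To decorate a tree vertex $x$ means: give $x$ a new reticulation child $\rho(x)$; give $\rho(x)$ a new leaf child $\ell(x)$; and give $\rho(x)$ a second parent $w(x)$, which is a tree vertex on a new bi-infinite spine, all of whose vertices other than $w(x)$ are in turn decorated, recursively (the reticulation child of $w(x)$ is $\rho(x)$). All spines and vertices introduced at every level are pairwise distinct. - $\hat{\mathcal{L}}$ is a bi-infinite spine $\cdots\to p_{-1}\to p_0\to p_1\to\cdots$ all of whose vertices are decorated, rooted at $p_0$. - $\hat{\mathcal{R}}$ has two disjoint bi-infinite spines $(p_i)_{i\in\mathbb{Z}}$ and $(q_i)_{i\in\mathbb{Z}}$, and a reticulation $\rho_0$ whose two parents are $p_0$ and $q_0$ and whose only child is a leaf $\ell_0$; every $p_i,q_i$ with $i\ne0$ is decorated, while $p_0,q_0$ have $\rho_0$ as their only reticulation child. It is rooted at $\rho_0$. - $\hat{\mathsf{N}}^{\mathrm{lf}}$ is the same directed graph as $\hat{\mathcal{R}}$, rooted at $\ell_0$ instead. *)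

(* Defs.v *)
From HB Require Import structures.
From mathcomp Require Import all_boot all_order all_algebra.
From mathcomp Require Import generic_quotient.
From mathcomp Require Import all_classical all_reals all_analysis.
From mathcomp Require Import zify.
Import Order.TTheory GRing.Theory Num.Theory numFieldNormedType.Exports.

Set Implicit Arguments.
Unset Strict Implicit.
Unset Printing Implicit Defensive.

Local Open Scope classical_set_scope.
Local Open Scope ring_scope.
Local Open Scope quotient_scope.

Inductive vtype := Root | TreeVertex | Reticulation | Leaf.

Record mgraph := MGraph {
  vert :> Type;
  edge : vert -> vert -> Prop;
  mark : vert -> vtype }.

Record rooted_graph := RootedGraph {
  graph :> mgraph;
  root_of : graph }.
Arguments root_of : clear implicits.

Definition rooted_iso (G H : rooted_graph) : Prop :=
  exists f : G -> H,
    [/\ bijective f,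
        f (root_of G) = root_of H,
        forall x, mark (f x) = mark x &
        forall x y, edge (f x) (f y) <-> edge x y].

(* The vertices at undirected distance at most r from v. *)
Fixpoint gball (N : mgraph) (r : nat) (v : N) : set N :=
  if r is r'.+1 then
    [set u | exists2 w, gball r' v w & [\/ u = w, edge w u | edge u w]]
  else [set v].

Lemma gball_center (N : mgraph) r (v : N) : v \in gball r v.
Proof.
apply: mem_set; elim: r => [//|r IH]; exists v => //.
by apply: Or31.
Qed.

(* The carrier is the coercion [set_type], {u | u \in gball r v}. *)
Definition nbhd_graph (N : mgraph) (r : nat) (v : N) : mgraph :=
  {| vert := gball r v;
     edge := fun x y => edge (val x) (val y);
     mark := fun x => mark (val x) |}.

Definition nbhd_at (N : mgraph) (r : nat) (v : N) : rooted_graph :=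
  @RootedGraph (nbhd_graph r v) (exist _ v (gball_center r v)).

(* A set of directed edges, and the map sending each label to a vertex. *)
Definition lgraph (n : nat) (V : finType) : Type :=
  {set V * V} * {ffun 'I_n -> V}.

Section Networks.
Variables (n : nat) (V : finType) (N : lgraph n V).

Definition darc : rel V := fun u v => (u, v) \in N.1.
Definition indeg (v : V) : nat := #|[set u | darc u v]%SET|.
Definition outdeg (v : V) : nat := #|[set w | darc v w]%SET|.
Definition degree (v : V) : nat * nat := (indeg v, outdeg v).

Definition is_leaf v := degree v == (1%N, 0%N).
Definition is_tree v := degree v == (1%N, 2%N).
Definition is_ret v := degree v == (2%N, 1%N).

Definition acyclic : bool :=
  [forall u, forall v, darc u v ==> ~~ connect darc v u].

Definition phylogenetic_root (o : V) : bool :=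
  [&& degree o == (0%N, 1%N),
      [forall v, connect darc o v] &
      [forall v, (v != o) ==> [|| is_leaf v, is_tree v | is_ret v]]].

Definition leaves_labelled : bool :=
  injectiveb N.2 && [forall v, (v \in codom N.2) == is_leaf v].

Definition tree_child : bool :=
  [forall v, ~~ is_leaf v ==> [exists w, darc v w && (is_tree w || is_leaf w)]].

Definition one_component : bool :=
  [forall v, forall w, is_ret v && darc v w ==> is_leaf w].

Definition simplex_tree_child : bool :=
  [&& acyclic, [exists o, phylogenetic_root o], leaves_labelled,
      tree_child & one_component].

(* In a network, (1, 2) is the only degree left for the last case. *)
Definition degree_mark (v : V) : vtype :=
  if degree v == (0%N, 1%N) then Root
  else if is_leaf v then Leaf
  else if is_ret v then Reticulation
  else TreeVertex.

Definition mgraph_of : mgraph :=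
  {| vert := V; edge := darc; mark := degree_mark |}.

End Networks.

(* Concrete networks: the vertex set is 'I_m for an arbitrary m. *)
Definition cnetwork (n : nat) : Type :=
  {m : nat & {N : lgraph n 'I_m | simplex_tree_child N}}.

Definition clgraph n (N : cnetwork n) : lgraph n 'I_(tag N) := val (tagged N).

Definition cgraph n (N : cnetwork n) : mgraph := mgraph_of (clgraph N).

Definition network_iso n (M N : cnetwork n) : Prop :=
  exists f : 'I_(tag M) -> 'I_(tag N),
    [/\ bijective f,
        forall u v, darc (clgraph N) (f u) (f v) = darc (clgraph M) u v &
        forall i, (clgraph N).2 i = f ((clgraph M).2 i)].

Definition network_isob n (M N : cnetwork n) : bool := `[< network_iso M N >].

Lemma network_isob_refl n : reflexive (@network_isob n).
Proof. by move=> M; apply/asboolP; exists id; split=> //; exists id. Qed.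

Lemma network_iso_sym n (M N : cnetwork n) : network_iso M N -> network_iso N M.
Proof.
move=> [f [[g fK gK] fe fl]]; exists g; split; first by exists f.
- by move=> u v; rewrite -fe !gK.
- by move=> i; rewrite fl fK.
Qed.

Lemma network_isob_sym n : symmetric (@network_isob n).
Proof. by move=> M N; apply/asboolP/asboolP; apply: network_iso_sym. Qed.

Lemma network_isob_trans n : transitive (@network_isob n).
Proof.
move=> N M P /asboolP[f [fb fe fl]] /asboolP[g [gb ge gl]]; apply/asboolP.
exists (g \o f); split; first exact: bij_comp.
- by move=> u v /=; rewrite ge fe.
- by move=> i /=; rewrite gl fl.
Qed.

Definition network_equiv n : equiv_rel (cnetwork n) :=
  EquivRel (@network_isob n) (@network_isob_refl n) (@network_isob_sym n)
    (@network_isob_trans n).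

Definition network (n : nat) : Type := {eq_quot network_equiv n}.

HB.instance Definition _ n := Countable.on (network n).
HB.instance Definition _ n := EqQuotient.on (network n).

(* The next two sections show that [network n] is finite: a network with n
   leaves and k reticulations has 2n + 2k vertices, and k <= n. *)
Section Bound.
Variables (n : nat) (V : finType) (N : lgraph n V).

Lemma sum_degrees : (\sum_v indeg N v = \sum_v outdeg N v)%N.
Proof.
under eq_bigr => v _ do rewrite /indeg cardsE -sum1_card.
under [RHS]eq_bigr => v _ do rewrite /outdeg cardsE -sum1_card.
by rewrite (exchange_big_dep xpredT) //=.
Qed.

Hypothesis stcN : simplex_tree_child N.

Lemma card_leaves : #|[pred v | is_leaf N v]| = n.
Proof.
case/and5P: stcN => _ _ /andP[/injectiveP inj /forallP leafP] _ _.
rewrite -[RHS](card_ord n) -(card_codom inj).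
by apply: eq_card => v; rewrite !inE; have /eqP <- := leafP v.
Qed.

Lemma card_rets : (#|[pred v | is_ret N v]| <= n)%N.
Proof.
case/and5P: stcN => _ _ _ _ /forallP one.
pose f v := odflt v [pick w | darc N v w].
have fP v : is_ret N v -> darc N v (f v).
  rewrite /f /is_ret => /eqP[_ out1]; case: pickP => [w //|no].
  by move: out1; rewrite /outdeg cardsE eq_card0.
have fleaf v : is_ret N v -> is_leaf N (f v).
  move=> rv; have /forallP/(_ (f v))/implyP := one v; apply.
  by rewrite rv fP.
have finj : {in [pred v | is_ret N v] &, injective f}.
  move=> u v; rewrite !inE => ru rv fuv.
  have := fleaf _ rv; rewrite /is_leaf xpair_eqE /indeg => /andP[/cards1P[w wE] _].
  have : u \in [set x | darc N x (f v)]%SET by rewrite inE -fuv fP.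
  have : v \in [set x | darc N x (f v)]%SET by rewrite inE fP.
  by rewrite wE !inE => /eqP -> /eqP ->.
rewrite -(card_in_image finj) -[X in (_ <= X)%N]card_leaves.
apply: subset_leq_card; apply/fintype.subsetP => _ /fintype.imageP[v rv ->].
exact: fleaf.
Qed.

Lemma card_vertices : (#|V| <= 4 * n)%N.
Proof.
case/and5P: (stcN) => _ /existsP[ o /and3P[/eqP oroot _ /forallP types]] _ _ _.
suff : (#|V| = 2 * n + 2 * #|[pred v | is_ret N v]|)%N.
  by have := card_rets; lia.
have E v : (1 + indeg N v = outdeg N v + 2 * is_leaf N v + 2 * is_ret N v)%N.
  have [->|vo] := eqVneq v o.
    by rewrite /is_leaf /is_ret oroot /=; case: oroot => -> ->.
  have := types v; rewrite vo /is_leaf /is_ret /is_tree /degree /=.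
  by case/or3P => /eqP[-> ->].
have : (\sum_v (1 + indeg N v) =
        \sum_v (outdeg N v + 2 * is_leaf N v + 2 * is_ret N v))%N.
  by apply: eq_bigr => v _; rewrite E.
rewrite big_split sum_degrees 2!big_split sum1_card /=.
have cnt (P : pred V) : (\sum_v 2 * P v = 2 * #|[pred v | P v]|)%N.
  rewrite -big_distrr /= -sum1_card [in RHS]big_mkcond; congr (2 * _)%N.
rewrite (cnt (is_leaf N)) (cnt (is_ret N)) card_leaves.
have -> : #|(xpredT : pred V)| = #|V| by exact: eq_card.
by lia.
Qed.

End Bound.

Section Finiteness.
Variable n : nat.

Definition network_enum : seq (network n) :=
  undup (flatten
    [seq [seq \pi_(network n) (existT _ m N : cnetwork n)
         | N <- enum {: {N : lgraph n 'I_m | simplex_tree_child N}}]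
    | m <- iota 0 (4 * n).+1]).

Lemma network_enumP : Finite.axiom network_enum.
Proof.
move=> x; rewrite count_uniq_mem ?undup_uniq // mem_undup; apply/eqP.
rewrite eqb1 -[x]reprK; case: (repr x) => m N.
apply/flattenP; exists [seq \pi_(network n) (existT _ m N : cnetwork n)
         | N <- enum {: {N : lgraph n 'I_m | simplex_tree_child N}}].
  apply/mapP; exists m => //; rewrite mem_iota /= add0n ltnS.
  by have := card_vertices (valP N); rewrite card_ord.
by apply/mapP; exists N; rewrite // mem_enum.
Qed.

HB.instance Definition _ := fintype.isFinite.Build (network n) network_enumP.

End Finiteness.

Definition nbhd_prop (R : realType) n (N : cnetwork n) (r : nat)
    (G : rooted_graph) : R :=
  #|[set v : 'I_(tag N) | `[< rooted_iso (@nbhd_at (cgraph N) r v) G >]]%SET|%:R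
  / #|'I_(tag N)|%:R.

Lemma rooted_iso_sym (G H : rooted_graph) : rooted_iso G H -> rooted_iso H G.
Proof.
move=> [f [[g fK gK] fr fm fe]]; exists g; split; first by exists f.
- by rewrite -fr fK.
- by move=> x; rewrite -fm gK.
- by move=> x y; rewrite -fe !gK.
Qed.

Lemma rooted_iso_trans (G H K : rooted_graph) :
  rooted_iso G H -> rooted_iso H K -> rooted_iso G K.
Proof.
move=> [f [fb fr fm fe]] [g [gb gr gm ge]]; exists (g \o f); split.
- exact: bij_comp.
- by rewrite /= fr gr.
- by move=> x /=; rewrite gm fm.
- by move=> x y /=; rewrite ge fe.
Qed.

Lemma nbhd_at_iso (M N : mgraph) (f : M -> N) (r : nat) (v : M) :
  bijective f -> (forall x, mark (f x) = mark x) ->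
  (forall x y, edge (f x) (f y) <-> edge x y) ->
  rooted_iso (nbhd_at r v) (nbhd_at r (f v)).
Proof.
move=> [g fK gK] fm fe.
have ballf s u : gball s v u <-> gball s (f v) (f u).
  elim: s u => [|s IH] u /=; first by split=> [->|/(can_inj fK)].
  split=> [[w /IH bw wu]|[w]].
    exists (f w) => //; case: wu => [->|wu|uw]; first exact: Or31.
      by apply: Or32; apply/fe.
    by apply: Or33; apply/fe.
  rewrite -(gK w) => /IH bw wu; exists (g w) => //.
  by case: wu => [/(can_inj fK)|/fe|/fe] ?; [apply: Or31|apply: Or32|apply: Or33].
have fin (x : nbhd_graph r v) : f (val x) \in gball r (f v).
  by apply/mem_set/ballf/set_mem/(valP x).
have gin (y : nbhd_graph r (f v)) : g (val y) \in gball r v.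
  by apply/mem_set/ballf; rewrite gK; apply/set_mem/(valP y).
exists (fun x => exist _ (f (val x)) (fin x)); split.
- exists (fun y => exist _ (g (val y)) (gin y)) => x; apply: val_inj.
    by rewrite /= fK.
  by rewrite /= gK.
- exact: val_inj.
- by move=> x; apply: fm.
- by move=> x y; apply: fe.
Qed.

(* Hence [nbhd_prop] may be evaluated at the representative [repr N] of a
   class N : network n. *)
Lemma nbhd_prop_iso (R : realType) n (M N : cnetwork n) (r : nat)
    (G : rooted_graph) :
  network_iso M N -> nbhd_prop R M r G = nbhd_prop R N r G.
Proof.
move=> [f [fb fe fl]]; have finj := bij_inj fb.
have deg v : degree (clgraph N) (f v) = degree (clgraph M) v.
  rewrite /degree /indeg /outdeg; congr (_, _).
    rewrite -(on_card_preimset (f := f)); last exact: onW_bij.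
    by apply: eq_card => u; rewrite !inE fe.
  rewrite -(on_card_preimset (f := f)); last exact: onW_bij.
  by apply: eq_card => u; rewrite !inE fe.
have fm v : @mark (cgraph N) (f v) = @mark (cgraph M) v.
  by rewrite /= /degree_mark /is_leaf /is_ret deg.
have fe' u v : @edge (cgraph N) (f u) (f v) <-> @edge (cgraph M) u v.
  by rewrite /= fe.
have nb v := @nbhd_at_iso (cgraph M) (cgraph N) f r v fb fm fe'.
rewrite /nbhd_prop (bij_eq_card fb); congr (_%:R / _).
rewrite -(on_card_preimset (f := f)); last exact: onW_bij.
apply: eq_card => v; rewrite !inE; apply: asbool_equiv_eq; split=> H.
  exact: rooted_iso_trans (rooted_iso_sym (nb v)) H.
exact: rooted_iso_trans (nb v) H.
Qed.

Definition uniform_prob (R : realType) (T : finType) (A : {set T}) : R :=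
  #|A|%:R / #|T|%:R.

(* Convergence in probability to the constant c, each T n carrying the uniform
   distribution. *)
Definition cvg_in_uniform_prob (R : realType) (T : nat -> finType)
    (X : forall n, T n -> R) (c : R) : Prop :=
  forall eps : R, 0 < eps ->
    uniform_prob R [set N : T n | eps < `|X n N - c|]%SET @[n --> \oo] --> (0 : R).

(* [Side s i] is the spine introduced when position i of s is decorated; it is
   indexed so that w(x) is its position 0. *)
Inductive spine (B : Type) := Base of B | Side of spine B & int.

Inductive dvertex (B : Type) :=
| Tr of spine B & int    (* the i-th vertex x of the spine s *)
| Rt of spine B & int    (* rho(x) *)
| Lf of spine B & int.   (* l(x) *)

Arguments Side {B}.
Arguments Tr {B}.
Arguments Rt {B}.
Arguments Lf {B}.

Section Decoration.
(* The initial spines, and which of their positions are decorated. *)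
Variables (B : Type) (dec : B -> int -> bool).

Definition decorated (s : spine B) (i : int) : bool :=
  match s with Base b => dec b i | Side _ _ => i != 0 end.

Fixpoint spine_exists (s : spine B) : bool :=
  match s with Base _ => true | Side s' i => spine_exists s' && decorated s' i end.

Definition dvertex_exists (x : dvertex B) : bool :=
  match x with
  | Tr s i => spine_exists s
  | Rt s i | Lf s i => spine_exists s && decorated s i
  end.

Definition decoration : Type := {x : dvertex B | dvertex_exists x}.

Inductive dedge : dvertex B -> dvertex B -> Prop :=
| DSpine s i : dedge (Tr s i) (Tr s (i + 1))
| DFirst s i : dedge (Tr s i) (Rt s i)
| DSecond s i : dedge (Tr (Side s i) 0) (Rt s i)
| DLeaf s i : dedge (Rt s i) (Lf s i).

Definition dmark (x : dvertex B) : vtype :=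
  match x with Tr _ _ => TreeVertex | Rt _ _ => Reticulation | Lf _ _ => Leaf end.

End Decoration.

Definition Lhat_dec (_ : unit) (_ : int) : bool := true.

Definition Lhat_graph : mgraph :=
  {| vert := decoration Lhat_dec;
     edge := fun x y => dedge (val x) (val y);
     mark := fun x => dmark (val x) |}.

Definition Lhat : rooted_graph :=
  @RootedGraph Lhat_graph (exist _ (Tr (Base tt) 0) erefl).

(* The spines (p_i) and (q_i) are [Base true] and [Base false]. *)
Definition Rhat_dec (_ : bool) (i : int) : bool := i != 0.

Inductive Rhat_vertex :=
| Decorated of decoration Rhat_dec
| Rho0
| Ell0.

Inductive Rhat_edge : Rhat_vertex -> Rhat_vertex -> Prop :=
| RDecorated x y : dedge (val x) (val y) -> Rhat_edge (Decorated x) (Decorated y)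
| RParent (b : bool) :
    Rhat_edge (Decorated (exist _ (Tr (Base b) 0) erefl)) Rho0
| RLeaf : Rhat_edge Rho0 Ell0.

Definition Rhat_mark (x : Rhat_vertex) : vtype :=
  match x with
  | Decorated y => dmark (val y)
  | Rho0 => Reticulation
  | Ell0 => Leaf
  end.

Definition Rhat_graph : mgraph :=
  {| vert := Rhat_vertex; edge := Rhat_edge; mark := Rhat_mark |}.

Definition Rhat : rooted_graph := @RootedGraph Rhat_graph Rho0.
Definition Nhat_lf : rooted_graph := @RootedGraph Rhat_graph Ell0.

(* The law of (N^*, v^* ), as a list of weighted atoms. *)
Definition Nstar (R : realType) : seq (R * rooted_graph) :=
  [:: (2^-1, Lhat); (4^-1, Rhat); (4^-1, Nhat_lf)].

Definition Nstar_prob (R : realType) (A : rooted_graph -> Prop) : R :=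
  \sum_(a <- Nstar R | `[< A a.2 >]) a.1.

Definition nbhd (H : rooted_graph) (r : nat) : rooted_graph := nbhd_at r (root_of H).

(* Main.v *)
Require Import Defs.
From mathcomp Require Import all_boot all_order all_algebra all_fingroup.
From mathcomp Require Import generic_quotient.
From mathcomp Require Import all_classical all_reals all_analysis.
From mathcomp Require Import zify ring lra.

Set Implicit Arguments.
Unset Strict Implicit.
Unset Printing Implicit Defensive.

(** A network with n leaves and k reticulations has 2n + 2k vertices.  Deleting
    the reticulations and the leaves below them leaves a tree with n - k leaves,
    n - k - 1 branching vertices and 2k unary vertices, the latter being matched
    in pairs by the reticulations.  Two facts suffice.

    - n - k is typically o(n): at most exp(O(n)) n^(n + k) networks have k
      reticulations (count arc sets of labelled digraphs and divide by the size
      of a labelling class), while caterpillars alone give ((n - 1)!)^2 networks.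
    - Few unary vertices lie on a short undirected cycle: exchanging the
      reticulation children of such a vertex and of a far away unary vertex is
      an injective operation that breaks the cycle, and few networks with two
      marked unary vertices arise this way.

    Around every other vertex the network has no branching vertex, no root, no
    ordinary leaf and no short cycle, so the map from the limit network that
    follows spines and reticulations is a local covering, injective on balls;
    hence the ball is the one in the limit network of the same vertex type.  The
    three types have frequencies (n + k, k, n) / (2n + 2k) ~ (1/2, 1/4, 1/4). *)

Local Open Scope classical_set_scope.
Local Open Scope quotient_scope.

(** * Degrees and orders in simplex tree-child networks *)

Arguments darc : simpl never.
Arguments degree : simpl never.

Section NetworkBasics.
Variables (n : nat) (V : finType) (N : lgraph n V).

Lemma acyclic_of_rank (rk : V -> nat) :
  (forall x y, darc N x y -> rk x < rk y)%N -> acyclic N.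
Proof.
move=> rkP; apply/forallP => u; apply/forallP => v; apply/implyP => uv.
apply/negP => /connectP[p pth uE].
have : (rk v <= rk u)%N.
  rewrite {}uE; elim: p v pth {uv} => //= w p IH v /andP[/rkP vw /IH].
  by apply: leq_trans; apply: ltnW.
by have := rkP _ _ uv; lia.
Qed.

Definition ancestors (x : V) : nat := #|[pred y | connect (darc N) y x]|.

(** Every ancestor of [x] is one of [y], and [y] counts among its own ancestors but, by acyclicity,
    not among those of [x]. This makes [ancestors] the rank for inductions along arcs. *)
Lemma ancestors_lt x y : acyclic N -> darc N x y -> (ancestors x < ancestors y)%N.
Proof.
move=> /forallP/(_ x)/forallP/(_ y)/implyP ac xy; apply: proper_card.
apply/fintype.properP; split.
  apply/fintype.subsetP => z; rewrite !inE => zx.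
  exact: connect_trans zx (connect1 xy).
by exists y; rewrite !inE ?connect0 ?ac.
Qed.

Lemma connect_from_root (rk : V -> nat) (o : V) :
  (forall x y, darc N x y -> rk x < rk y)%N ->
  (forall v, v != o -> (0 < indeg N v)%N) ->
  forall v, connect (darc N) o v.
Proof.
move=> rkP inP v; have [m] := ubnP (rk v); elim: m v => // m IH v vm.
have [->|/inP] := eqVneq v o; first exact: connect0.
rewrite card_gt0 => /set0Pn[u]; rewrite inE => uv.
by apply: connect_trans (connect1 uv); apply: IH; have := rkP _ _ uv; lia.
Qed.

(** A criterion for building networks: an increasing rank replaces both acyclicity and reachability,
    the latter because climbing to parents must end at the only vertex without one. *)
Lemma simplex_of_rank (rk : V -> nat) (o : V) :
  (forall x y, darc N x y -> rk x < rk y)%N ->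
  degree N o = (0%N, 1%N) ->
  (forall v, v != o -> [|| is_leaf N v, is_tree N v | is_ret N v]) ->
  leaves_labelled N -> tree_child N -> one_component N ->
  simplex_tree_child N.
Proof.
move=> rkP oP typ ll tc oc; apply/and5P; split=> //.
  exact: acyclic_of_rank rkP.
apply/existsP; exists o; apply/and3P; split; first exact/eqP.
- apply/forallP; apply: connect_from_root rkP _ => v /typ.
  by rewrite /is_leaf /is_tree /is_ret /degree => /or3P[]/eqP[-> _].
- by apply/forallP => v; apply/implyP => /typ.
Qed.

Lemma has_parent v : (0 < indeg N v)%N -> exists u, darc N u v.
Proof. by rewrite card_gt0 => /set0Pn[u]; rewrite inE => uv; exists u. Qed.

Lemma indeg1_inj v x y : indeg N v = 1%N -> darc N x v -> darc N y v -> x = y.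
Proof.
move=> /eqP/cards1P[z zE] xv yv.
have : x \in [set u | darc N u v]%SET by rewrite inE.
have : y \in [set u | darc N u v]%SET by rewrite inE.
by rewrite zE !inE => /eqP-> /eqP->.
Qed.

Lemma outdeg1_inj v x y : outdeg N v = 1%N -> darc N v x -> darc N v y -> x = y.
Proof.
move=> /eqP/cards1P[z zE] xv yv.
have : x \in [set u | darc N v u]%SET by rewrite inE.
have : y \in [set u | darc N v u]%SET by rewrite inE.
by rewrite zE !inE => /eqP-> /eqP->.
Qed.

Lemma outdeg0 v x : outdeg N v = 0%N -> ~~ darc N v x.
Proof.
by move=> /eqP; rewrite cards_eq0 => /eqP/setP/(_ x); rewrite !inE => ->.
Qed.

Lemma outdeg2_cover v x y z : outdeg N v = 2%N -> x != y ->
  darc N v x -> darc N v y -> darc N v z -> z = x \/ z = y.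
Proof.
move=> o2 xy vx vy vz.
have sub : [set x; y]%SET \subset [set u | darc N v u]%SET.
  by apply/fintype.subsetP => w; rewrite !inE => /orP[]/eqP->.
have /subset_cardP/(_ sub)/(_ z) : #|[set x; y]%SET| = #|[set u | darc N v u]%SET|.
  by rewrite cards2 xy; apply: esym o2.
by rewrite !inE vz => /orP[]/eqP->; [left|right].
Qed.

Lemma indeg2_cover v x y z : indeg N v = 2%N -> x != y ->
  darc N x v -> darc N y v -> darc N z v -> z = x \/ z = y.
Proof.
move=> o2 xy vx vy vz.
have sub : [set x; y]%SET \subset [set u | darc N u v]%SET.
  by apply/fintype.subsetP => w; rewrite !inE => /orP[]/eqP->.
have /subset_cardP/(_ sub)/(_ z) : #|[set x; y]%SET| = #|[set u | darc N u v]%SET|.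
  by rewrite cards2 xy; apply: esym o2.
by rewrite !inE vz => /orP[]/eqP->; [left|right].
Qed.

Hypothesis stcN : simplex_tree_child N.

Lemma stc_acyclic : acyclic N.
Proof. by case/and5P: stcN. Qed.

Lemma darc_ancestors x y : darc N x y -> (ancestors x < ancestors y)%N.
Proof. exact: ancestors_lt stc_acyclic. Qed.

Lemma stc_rootP : exists o, degree N o = (0%N, 1%N) /\
  (forall v, v != o -> [|| is_leaf N v, is_tree N v | is_ret N v]).
Proof.
case/and5P: stcN => _ /existsP[ o /and3P[/eqP od _ /forallP typ]] _ _ _.
by exists o; split=> // v vo; have := typ v; rewrite vo.
Qed.

Lemma stc_type v : [|| degree N v == (0%N, 1%N), is_leaf N v, is_tree N v | is_ret N v].
Proof.
by have [ o [od typ]] := stc_rootP; have [->|/typ->] := eqVneq v o; rewrite ?od ?eqxx ?orbT.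
Qed.

Lemma tree_childP v : ~~ is_leaf N v -> exists2 w, darc N v w & is_tree N w || is_leaf N w.
Proof.
case/and5P: stcN => _ _ _ /forallP tc _ nl.
by have := implyP (tc v) nl => /existsP[w /andP[vw tw]]; exists w.
Qed.

Lemma ret_child v w : is_ret N v -> darc N v w -> is_leaf N w.
Proof.
case/and5P: stcN => _ _ _ _ /forallP/(_ v)/forallP/(_ w)/implyP oc rv vw.
by apply: oc; rewrite rv.
Qed.

Lemma leafP v : reflect (exists i, v = N.2 i) (is_leaf N v).
Proof.
case/and5P: stcN => _ _ /andP[_ /forallP/(_ v)/eqP<-] _ _.
by apply: (iffP codomP).
Qed.

Lemma label_inj : injective N.2.
Proof. by case/and5P: stcN => _ _ /andP[/injectiveP]. Qed.

Lemma leaf_out v x : is_leaf N v -> ~~ darc N v x.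
Proof. by case/eqP=> _ o0; apply: outdeg0. Qed.

(** A root has a single child, which is a tree vertex or a leaf by the tree-child condition, and the
    child of a reticulation is a leaf. *)
Lemma ret_parent u v : is_ret N v -> darc N u v -> is_tree N u.
Proof.
move=> rv uv; have : ~~ is_leaf N u by apply: contraL uv; apply: leaf_out.
have := stc_type u => /or4P[/eqP[_ o1]|->//|//|ru] nl.
  have [w uw tw] := tree_childP nl; rewrite (outdeg1_inj o1 uv uw) in rv.
  by move: tw rv; rewrite /is_tree /is_leaf /is_ret => /orP[]/eqP->.
by move: rv; rewrite /is_ret (eqP (ret_child ru uv)).
Qed.

(** The common parent is a tree vertex with two children, one of which is not a reticulation by the
    tree-child condition. *)
Lemma ret_child_inj u v w : is_ret N v -> is_ret N w -> darc N u v -> darc N u w -> v = w.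
Proof.
move=> rv rw uv uw; apply/eqP/negPn/negP => vw.
have tu := ret_parent rv uv.
have [|x ux tx] := @tree_childP u; first by rewrite /is_leaf (eqP tu).
have nr : ~~ is_ret N x.
  by move: tx; rewrite /is_tree /is_leaf /is_ret => /orP[]/eqP->.
have := outdeg2_cover _ vw uv uw ux; case; first by case/eqP: tu.
  by move=> xv; rewrite xv rv in nr.
by move=> xv; rewrite xv rw in nr.
Qed.

Definition nrets : nat := #|[set v | is_ret N v]%SET|.

Lemma nretsE : nrets = #|[pred v | is_ret N v]|.
Proof. by apply: eq_card => v; rewrite !inE. Qed.

(** The local identity [E] between in- and outdegree holds at every vertex type; summed over all
    vertices, the degrees cancel. *)
Lemma card_vert : (#|V| = 2 * n + 2 * nrets)%N.
Proof.
have [ o [od typ]] := stc_rootP.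
have E v : (1 + indeg N v = outdeg N v + 2 * is_leaf N v + 2 * is_ret N v)%N.
  have [->|vo] := eqVneq v o.
    by rewrite /is_leaf /is_ret od /=; case: od => -> ->.
  have := typ v vo; rewrite /is_leaf /is_ret /is_tree /degree /=.
  by case/or3P => /eqP[-> ->].
have : (\sum_v (1 + indeg N v) =
        \sum_v (outdeg N v + 2 * is_leaf N v + 2 * is_ret N v))%N.
  by apply: eq_bigr => v _; rewrite E.
rewrite big_split (sum_degrees N) 2!big_split sum1_card /=.
have cnt (P : pred V) : (\sum_v 2 * P v = 2 * #|[pred v | P v]|)%N.
  by rewrite -big_distrr /= -sum1_card [in RHS]big_mkcond.
rewrite (cnt (is_leaf N)) (cnt (is_ret N)) (card_leaves stcN) -nretsE.
have -> : #|(xpredT : pred V)| = #|V| by exact: eq_card.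
by lia.
Qed.

Lemma nrets_le : (nrets <= n)%N.
Proof. by rewrite nretsE; apply: card_rets stcN. Qed.

(** Arcs are counted by their heads: indegree 1 everywhere, except 0 at the root and 2 at the
    reticulations. *)
Lemma card_arcs : (#|N.1| = 2 * n + 3 * nrets - 1)%N.
Proof.
have [ o [od typ]] := stc_rootP.
have -> : (#|N.1| = \sum_v indeg N v)%N.
  rewrite -sum1_card (eq_bigr (fun p : V * V => 1%N)) //.
  rewrite (eq_bigl (fun p : V * V => xpredT p.1 && darc N p.1 p.2)); last by case.
  rewrite -(pair_big_dep xpredT (darc N) (fun _ _ => 1%N)) (exchange_big_dep xpredT) //=.
  by apply: eq_bigr => v _; rewrite sum1_card /indeg cardsE.
have E v : (indeg N v + (v == o) = 1 + is_ret N v)%N.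
  have [->|vo] := eqVneq v o.
    by rewrite /is_ret od /=; case: od => -> _.
  have := typ v vo; rewrite /is_leaf /is_ret /is_tree /degree /=.
  by case/or3P => /eqP[-> ->].
have : (\sum_v (indeg N v + (v == o)) = \sum_v (1 + is_ret N v))%N.
  by apply: eq_bigr => v _; rewrite E.
rewrite !big_split /= sum1_card -big_mkcond sum1_card -[in X in _ = X]big_mkcond.
rewrite (eq_card (B := pred1 o)) // card1 sum1_card /=.
rewrite -nretsE.
have -> : #|(xpredT : pred V)| = #|V| by exact: eq_card.
rewrite card_vert; lia.
Qed.

End NetworkBasics.

Lemma count_le_one (T : finType) (P : pred T) :
  (forall x y, P x -> P y -> x = y) -> (#|P| <= [exists x, P x])%N.
Proof.
move=> inj; have [/existsP[x Px]|/existsPn no] := boolP [exists x, P x].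
  apply: (@leq_trans #|pred1 x|); last by rewrite card1.
  apply: subset_leq_card; apply/fintype.subsetP => y Py.
  by rewrite inE (inj _ _ Py Px).
by rewrite eq_card0 // => x; apply/negbTE/no.
Qed.

(** Double counting of the pairs [(c, v)] with [e c v]: each [v] occurs with at most one [c]. *)
Lemma card_image_rel (T : finType) (e : rel T) (P : pred T) d :
  (forall c, P c -> #|[set v | e c v]%SET| = d) ->
  (forall v c c', P c -> P c' -> e c v -> e c' v -> c = c') ->
  (d * #|P| <= #|[set v | [exists c, P c && e c v]]%SET|)%N.
Proof.
move=> deg inj; have -> : (d * #|P| = \sum_(c | P c) \sum_(v | e c v) 1)%N.
  rewrite mulnC -sum_nat_const; apply: eq_bigr => c Pc.
  by rewrite sum1_card -(deg c Pc) cardsE.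
rewrite (exchange_big_dep xpredT) //= cardsE -sum1_card big_mkcond /=.
rewrite [leqRHS]big_mkcond; apply: leq_sum => v _ /=.
rewrite sum1_card; apply: leq_trans (count_le_one _) _ => [x y|] /=.
  by move=> /andP[Px xv] /andP[Py yv]; apply: inj xv yv.
by rewrite unfold_in; case: ifP.
Qed.

(** * Unary vertices and regular vertices *)

Section Regular.
Variables (n : nat) (V : finType) (N : lgraph n V).

(** Such a vertex keeps a single child once the reticulations are deleted. *)
Definition unary (v : V) : bool := [exists c, is_ret N c && darc N v c].

(** The vertices left out are the root, the branching vertices and the leaves not below a
    reticulation; the limit networks have none of these. *)
Definition regular (v : V) : bool :=
  [|| is_ret N v, unary v | [exists c, is_ret N c && darc N c v]].

Hypothesis stcN : simplex_tree_child N.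

Lemma unary_tree v : unary v -> is_tree N v.
Proof. by case/existsP => c /andP[rc]; apply: ret_parent. Qed.

Lemma card_unary : (2 * nrets N <= #|[set v | unary v]%SET|)%N.
Proof.
rewrite nretsE; apply: (@card_image_rel _ (fun c v => darc N v c)).
  by move=> c /eqP[].
by move=> v c c' rc rc'; apply: (ret_child_inj stcN).
Qed.

Lemma card_ret_leaf :
  (nrets N <= #|[set v | [exists c, is_ret N c && darc N c v]]%SET|)%N.
Proof.
rewrite nretsE -[leqLHS]mul1n; apply: card_image_rel.
  by move=> c /eqP[].
move=> v c c' rc rc' cv; have /eqP[i1 _] := ret_child stcN rc cv.
exact: indeg1_inj i1 cv.
Qed.

(** The three kinds of regular vertices are disjoint and number at least k, 2k and k, out of 2n + 2k
    vertices. *)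
Lemma card_nonregular :
  (#|[set v | ~~ regular v]%SET| + 2 * nrets N <= 2 * n)%N.
Proof.
have disj1 v : is_ret N v -> ~~ unary v.
  by move=> rv; apply/negP => /unary_tree; move: rv; rewrite /is_tree /is_ret => /eqP->.
have disj2 v : [exists c, is_ret N c && darc N c v] -> ~~ is_ret N v && ~~ unary v.
  move=> /existsP[c /andP[rc cv]]; have lv := ret_child stcN rc cv.
  apply/andP; split; first by rewrite /is_ret (eqP lv).
  by apply/negP => /unary_tree; rewrite /is_tree (eqP lv).
have := cardsC [set v | ~~ regular v]%SET.
set A := [set v | is_ret N v]%SET; set B := [set v | unary v]%SET.
set C := [set v | [exists c, is_ret N c && darc N c v]]%SET.
have -> : (~: [set v | ~~ regular v] = A :|: B :|: C)%SET.
  by apply/setP => v; rewrite !inE negbK /regular orbA.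
rewrite cardsU cardsU.
have -> : (A :&: B = finset.set0)%SET.
  by apply/setP => v; rewrite !inE; apply/negP => /andP[/disj1/negP].
have -> : ((A :|: B) :&: C = finset.set0)%SET.
  by apply/setP => v; rewrite !inE; apply/negP => /andP[rv /disj2/andP[nr nu]];
   move: rv; rewrite (negbTE nr) (negbTE nu).
rewrite cards0 !subn0 (card_vert stcN).
have := card_unary; have := card_ret_leaf; rewrite -/B -/C.
have -> : #|A| = nrets N by [].
lia.
Qed.

End Regular.

(** * Balls around sets of vertices and their size *)

Section Neighbourhoods.
Variables (T : finType).
Implicit Types (e : rel T) (S : {set T}).

Definition thicken e S : {set T} := (S :|: [set y | [exists x, (x \in S) && e x y]])%SET.

(** The counterpart of [gball] as a finite set, so that balls can be counted. *)
Definition hood e l S : {set T} := iter l (thicken e) S.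

Lemma card_thicken e d S :
  (forall x, #|[set y | e x y]%SET| <= d)%N -> (#|thicken e S| <= d.+1 * #|S|)%N.
Proof.
move=> ed; apply: leq_trans (leq_card_setU _ _) _; rewrite mulSn leq_add2l.
have -> : [set y | [exists x, (x \in S) && e x y]]%SET
    = (\bigcup_(x in S) [set y | e x y])%SET.
  apply/setP => y; rewrite inE; apply/existsP/bigcupP.
    by case=> x /andP[xS xy]; exists x; rewrite ?inE.
  by case=> x xS; rewrite inE => xy; exists x; rewrite xS.
apply: (@leq_trans (\sum_(x in S) #|[set y | e x y]%SET|)%N).
  elim/big_rec2: _ => [|x m A _ IH]; first by rewrite cards0.
  by apply: leq_trans (leq_card_setU _ _) _; rewrite leq_add2l.
by rewrite mulnC -sum_nat_const; apply: leq_sum.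
Qed.

Lemma card_hood e d l S :
  (forall x, #|[set y | e x y]%SET| <= d)%N -> (#|hood e l S| <= d.+1 ^ l * #|S|)%N.
Proof.
move=> ed; elim: l => [|l IH]; first by rewrite mul1n.
rewrite /hood iterS; apply: leq_trans (card_thicken _ ed) _.
by rewrite expnS -mulnA leq_mul2l IH orbT.
Qed.

Lemma thicken_sub e S : S \subset thicken e S.
Proof. exact: finset.subsetUl. Qed.

Lemma hood_mono e l m S : (l <= m)%N -> hood e l S \subset hood e m S.
Proof.
move=> /subnK <-; elim: (m - l)%N => [//|k IH].
by rewrite addSn /hood iterS; apply: fintype.subset_trans IH _; apply: thicken_sub.
Qed.

Lemma thickenP e S x y : x \in S -> e x y -> y \in thicken e S.
Proof.
by move=> xS xy; rewrite !inE; apply/orP; right; apply/existsP; exists x; rewrite xS.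
Qed.

Lemma thicken_mono e e' S S' :
  subrel e e' -> S \subset S' -> thicken e S \subset thicken e' S'.
Proof.
move=> ee SS; apply/fintype.subsetP => y; rewrite !inE => /orP[/(fintype.subsetP SS)->//|].
move=> /existsP[x /andP[xS /ee xy]]; apply/orP; right; apply/existsP; exists x.
by rewrite (fintype.subsetP SS).
Qed.

Lemma hood_step e l y S : y \in hood e l (thicken e S) -> y \in hood e l.+1 S.
Proof. by rewrite /hood iterSr. Qed.

Lemma hood_path e l x p S : x \in S -> path e x p -> (size p <= l)%N ->
  {subset p <= hood e l S}.
Proof.
elim: p x l S => // y p IH x [//|l] S xS /= /andP[xy pth] sz z.
rewrite inE => /orP[/eqP->|zp].
  by apply: (fintype.subsetP (hood_mono _ _ (_ : 1 <= l.+1)%N)) => //; apply: thickenP xy.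
by apply: hood_step; apply: (IH y) zp => //; apply: thickenP xy.
Qed.

End Neighbourhoods.

(** * Local coverings *)

Section Walks.
Variable T : Type.
Implicit Types (e : T -> T -> Prop) (x y : T) (p : seq T).

Fixpoint walk e x p : Prop := if p is y :: p' then e x y /\ walk e y p' else True.

Fixpoint nobacktrack x p : Prop :=
  if p is y :: p' then
    (if p' is z :: _ then x <> z else True) /\ nobacktrack y p'
  else True.

Lemma walk_rcons e x p y : walk e x p -> e (last x p) y -> walk e x (rcons p y).
Proof. by elim: p x => //= z p IH x [xz /IH] H /H. Qed.

Lemma walk_cat e x p q : walk e x p -> walk e (last x p) q -> walk e x (p ++ q).
Proof. by elim: p x => //= z p IH x [xz /IH] H /H. Qed.

(** The tail is reduced first; if it then returns to [x] at its second step, both steps are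
    dropped. *)
Lemma walk_reduce e x p : walk e x p ->
  exists q, [/\ walk e x q, nobacktrack x q, last x q = last x p & (size q <= size p)%N].
Proof.
elim: p x => [|y p IH] x /=; first by exists [::].
move=> [xy /IH[[|z q] [/= wq nq lq sq]]]; first by exists [:: y].
have [xz|xz] := pselect (x = z); last by exists [:: y, z & q].
exists q; rewrite xz; case: wq nq => _ wq [_ nq]; split=> //.
by apply: leq_trans (ltnW sq) _.
Qed.

End Walks.

(** Take the last position whose vertex recurs later: the walk up to the recurrence is simple.
    Length 1 is excluded by irreflexivity, length 2 by the absence of backtracking. *)
Lemma nobacktrack_cycle (T : eqType) (e : rel T) x p : irreflexive e ->
  path e x p -> nobacktrack x p -> ~~ uniq (x :: p) ->
  exists s, [/\ path.cycle e s, uniq s, (3 <= size s <= size p)%N & {subset s <= x :: p}].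
Proof.
move=> irr; elim: p x => // y p IH x pth nb nu.
have [u|nu'] := boolP (uniq (y :: p)); last first.
  have [||s [cs us /andP[s3 sp] ss]] := IH y _ _ nu'.
  - by case/andP: pth.
  - by case: nb.
  exists s; split=> //; first by rewrite s3 ltnW.
  by move=> z /ss zp; rewrite inE zp orbT.
have xp : x \in y :: p by move: nu; rewrite [uniq _]/= -/(uniq (y :: p)) u andbT negbK.
have [p1 [p2 def]] : exists p1 p2, y :: p = p1 ++ x :: p2.
  by case/splitPr: xp => p1 p2; exists p1, p2.
rewrite def in u pth; move: pth.
rewrite cat_path /= => /and3P[pth lx _]; exists (x :: p1); split.
- by rewrite /= rcons_path pth.
- by move: u; rewrite cat_uniq /= => /and3P[-> /norP[-> _]].
- have := congr1 size def; rewrite size_cat /= => ->.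
  case: p1 def nb lx {pth u xp} => [|y' [|z p1]] /=.
  + by move=> _ _; rewrite irr.
  + by case=> _ -> [].
  + by move=> *; lia.
- by move=> z; rewrite inE in_cons def mem_cat => /orP[->|->]; rewrite ?orbT.
Qed.

Section LocalIsomorphism.
Variables (n : nat) (V : finType) (N : lgraph n V).
Hypothesis stcN : simplex_tree_child N.

Definition uadj : rel V := [rel x y | darc N x y || darc N y x].

Lemma darc_irr : irreflexive (darc N).
Proof. by move=> x; apply/negP => /(darc_ancestors stcN); rewrite ltnn. Qed.

Lemma darc_asym x y : darc N x y -> ~~ darc N y x.
Proof.
by move=> /(darc_ancestors stcN) xy; apply/negP => /(darc_ancestors stcN); lia.
Qed.

Lemma uadj_irr : irreflexive uadj.
Proof. by move=> x; rewrite /uadj /= darc_irr. Qed.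

Lemma degree_le v : (indeg N v + outdeg N v <= 3)%N.
Proof. by have := stc_type stcN v; case/or4P => /eqP[-> ->]. Qed.

Lemma card_uadj v : (#|[set y | uadj v y]%SET| <= 3)%N.
Proof.
apply: leq_trans (degree_le v); rewrite addnC.
apply: leq_trans (leq_card_setU _ _); apply: subset_leq_card.
by apply/fintype.subsetP => y; rewrite !inE /uadj.
Qed.

(** Removing [c] keeps the rest of a cycle away from the arc from [u] to [c], which a switch will
    move. *)
Definition avoid (c : V) : rel V := [rel x y | [&& uadj x y, x != c & y != c]].

(* Some undirected cycle of length at most L + 2 passes from u through a
   reticulation child of u. *)
Definition entangled (L : nat) (u : V) : bool :=
  [exists c, exists u', [&& is_ret N c, darc N u c, darc N u' c, u' != u &
     u' \in hood (avoid c) L [set u]%SET]].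

(* The last vertex of the cycle in the order of ancestors has both its cycle
   neighbours as parents. *)
Lemma cycle_entangled L s : path.cycle uadj s -> uniq s -> (3 <= size s <= L)%N ->
  exists2 u, u \in s & entangled L u.
Proof.
case: s => [//|x0 s0]; set s := x0 :: s0 => cs us /andP[s3 sL].
have x0s : x0 \in s by rewrite inE eqxx.
case: (@arg_maxnP _ x0 (mem s) (ancestors N) x0s) => c cin cmax.
have [i q rq] := rot_to cin.
have cq : path.cycle uadj (c :: q) by rewrite -rq rot_cycle.
have uq : uniq (c :: q) by rewrite -rq rot_uniq.
have sq : size s = (size q).+1 by rewrite -(size_rot i) rq.
have mq z : z \in q -> z \in s.
  by move=> zq; rewrite -(mem_rot i) rq inE zq orbT.
have into z : z \in s -> uadj c z || uadj z c -> darc N z c.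
  move=> /cmax zc; rewrite /uadj /=.
  by case/orP => /orP[] // /(darc_ancestors stcN); lia.
case: q cq uq sq mq {rq} => [|u [|w q]]; first by move=> _ _ sq; rewrite sq in s3.
  by move=> _ _ sq; rewrite sq in s3.
rewrite [path.cycle _ _]/= -cat1s -cats1.
set u' := last w q => /and3P[cu uw pth] /= /and4P[cq uq wq _] sq mq.
have u'q : u' \in w :: q by exact: mem_last.
have [pth1 u'c] : path uadj w q /\ uadj u' c.
  by move: pth; rewrite cats1 rcons_path => /andP[].
have uc : darc N u c by apply: into; rewrite ?cu ?mq ?inE ?eqxx.
have uc' : darc N u' c by apply: into; rewrite ?u'c ?orbT // mq // inE u'q orbT.
have uu' : u' != u by apply: contraNneq uq => <-.
have rc : is_ret N c.
  have := stc_type stcN c; case/or4P => [/eqP[i0 _]|/eqP[i1 _]|/eqP[i1 _]|//].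
  - by move/eqP: i0; rewrite cards_eq0 => /eqP/setP/(_ u); rewrite !inE uc.
  - by rewrite (indeg1_inj i1 uc' uc) eqxx in uu'.
  - by rewrite (indeg1_inj i1 uc' uc) eqxx in uu'.
exists u; first by rewrite mq // inE eqxx.
apply/existsP; exists c; apply/existsP; exists u'; rewrite rc uc uc' uu' /=.
have pth2 : path uadj u (w :: q) by rewrite /= uw.
apply: (@hood_path _ _ _ u (w :: q)) => //.
- by rewrite inE.
- have sub : {in predC1 c &, subrel uadj (avoid c)}.
    by move=> x y; rewrite !inE => xc yc; rewrite /avoid /= => ->; rewrite xc yc.
  apply: (sub_in_path sub) pth2; apply/allP => z zq /=.
  by apply: contraNneq cq => <-.
- by move: sL; rewrite /s /= sq => /ltnW/ltnW.
Qed.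

Section Covering.
Variables (H : mgraph) (a : H) (phi : H -> V) (r : nat).

Definition hadj (x y : H) : Prop := edge x y \/ edge y x.

Lemma gball_mono (M : mgraph) (v : M) i j : (i <= j)%N -> gball i v `<=` gball j v.
Proof.
move=> /subnK <-; elim: (j - i)%N => [|k IH] x //= /IH bx.
by exists x => //; apply: Or31.
Qed.

Lemma gball_step (M : mgraph) (v x y : M) i :
  gball i v x -> edge x y \/ edge y x -> gball i.+1 v y.
Proof. by move=> bx [xy|yx]; exists x => //; [apply: Or32|apply: Or33]. Qed.

(** On the ball of radius r + 1, [phi] has to preserve arcs and marks. The hypotheses on [H] make
    each vertex look like a network vertex of the same type; as nothing so far separates the two
    parents of a reticulation, [ret_nbrs] asks that their images differ. *)
Hypothesis phi_edge : forall x y, gball r.+1 a x -> gball r.+1 a y ->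
  edge x y -> darc N (phi x) (phi y).
Hypothesis phi_mark : forall x, gball r.+1 a x -> degree_mark N (phi x) = mark x.

Hypothesis out_mark : forall x y z : H, edge x y -> edge x z -> mark y = mark z -> y = z.
Hypothesis in_unique : forall x y z : H, edge y x -> edge z x ->
  mark x <> Reticulation -> y = z.
Hypothesis no_root : forall x : H, mark x <> Root.
Hypothesis tree_nbrs : forall x : H, mark x = TreeVertex ->
  exists y1 y2 y3, [/\ edge y1 x, edge x y2, edge x y3, mark y2 = TreeVertex
    & mark y3 = Reticulation].
Hypothesis ret_nbrs : forall x : H, mark x = Reticulation ->
  exists y1 y2 y3, [/\ edge y1 x, edge y2 x, edge x y3,
     (forall y, edge y x -> y = y1 \/ y = y2) &
     gball r.+1 a y1 -> gball r.+1 a y2 -> phi y1 <> phi y2].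
Hypothesis leaf_nbr : forall x : H, mark x = Leaf -> exists y, edge y x.

(** Two points of the ball are joined through [a] by a walk of at most 2(r + 1) steps, whence the
    length. *)
Hypothesis not_entangled : forall x, gball r.+1 a x -> ~~ entangled (2 * r.+1) (phi x).

Let B := gball r.+1 a.

Lemma phi_degree x : B x -> degree N (phi x) =
  match mark x with
  | Root => (0, 1) | TreeVertex => (1, 2) | Reticulation => (2, 1) | Leaf => (1, 0)
  end%N.
Proof.
move=> /phi_mark <-; rewrite /degree_mark.
have := stc_type stcN (phi x); rewrite /is_leaf /is_tree /is_ret.
by case/or4P => /eqP ->.
Qed.

(** Two children are told apart by their marks, a child and a parent by the asymmetry of arcs, and
    two parents occur only at a reticulation, where [ret_nbrs] applies. *)
Lemma covering_loc_inj x y z : B x -> B y -> B z -> hadj x y -> hadj x z ->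
  phi y = phi z -> y = z.
Proof.
move=> Bx By Bz [xy|yx] [xz|zx] yz.
- by apply: out_mark xy xz _; rewrite -(phi_mark By) -(phi_mark Bz) yz.
- have := phi_edge Bz Bx zx; rewrite -yz => /darc_asym.
  by rewrite phi_edge.
- have := phi_edge Bx Bz xz; rewrite -yz => /darc_asym.
  by rewrite phi_edge.
- have [xr|xr] := pselect (mark x = Reticulation); last exact: in_unique yx zx xr.
  have [y1 [y2 [_ [_ _ _ cov dif]]]] := ret_nbrs xr.
  case: (cov _ yx) => yE; case: (cov _ zx) => zE; rewrite ?yE ?zE //; exfalso.
    by apply: dif; rewrite -?yE -?zE.
  by apply: dif; rewrite -?yE -?zE.
Qed.

(** Walks are confined to the ball, where [phi] is controlled. *)
Definition badj (u w : H) : Prop := [/\ hadj u w, B u & B w].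

Lemma badj_sym u w : badj u w -> badj w u.
Proof. by case=> -[uw|wu] bu bw; split=> //; [right|left]. Qed.

Lemma gball_walk k x : gball k a x -> (k <= r.+1)%N ->
  (exists p, [/\ walk badj x p, last x p = a & (size p <= k)%N]) /\
  (exists p, [/\ walk badj a p, last a p = x & (size p <= k)%N]).
Proof.
elim: k x => [|k IH] x; first by move=> /= -> _; split; exists [::].
move=> xk kr; case: (xk) => w wk xw.
have [[p [wp lp sp]] [q [wq lq sq]]] := IH w wk (ltnW kr).
have Bx : B x by apply: gball_mono xk.
have Bw : B w by apply: gball_mono wk; apply: ltnW.
have adj : x = w \/ badj w x.
  by case: xw => [->|wx|xw]; [left|right; split=> //; left|right; split=> //; right].
case: adj => [->|wx]; first by split; [exists p|exists q]; split=> //; apply: leq_trans (leqnSn k).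
split; first by exists (w :: p); split=> //=; split=> //; apply: badj_sym.
exists (rcons q x); rewrite size_rcons last_rcons; split=> //.
by apply: walk_rcons; rewrite ?lq.
Qed.

Lemma covering_path x p : walk badj x p -> path uadj (phi x) (map phi p).
Proof.
elim: p x => //= y p IH x [[[xy|yx] Bx By] /IH ->]; rewrite andbT /uadj /=.
  by rewrite phi_edge.
by rewrite [darc N (phi y) _]phi_edge ?orbT.
Qed.

Lemma covering_nobacktrack x p : walk badj x p -> nobacktrack x p ->
  nobacktrack (phi x) (map phi p).
Proof.
elim: p x => //= y p IH x [xy wp] [xz nb]; split; last exact: IH.
case: p wp xz {IH nb} => //= z p [[yz _ Bz] _] xz /(@covering_loc_inj y x z) E.
case: xy => xy Bx By; apply: xz; apply: E => //.
by case: xy; [right|left].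
Qed.

(* Two points with the same image are joined by a reduced walk; its image is a
   reduced closed walk, which contains a short cycle. *)
Lemma covering_inj x y : B x -> B y -> phi x = phi y -> x = y.
Proof.
move=> Bx By xy; have [[p [wp lp sp]] _] := @gball_walk r.+1 x Bx (leqnn _).
have [_ [q [wq lq sq]]] := @gball_walk r.+1 y By (leqnn _).
have wpq : walk badj x (p ++ q) by apply: walk_cat; rewrite ?lp.
have [s [ws ns ls ss]] := walk_reduce wpq.
move: ls; rewrite last_cat lp lq => ls.
case: s ws ns ls ss => [//|z s] ws ns ls ss; exfalso.
have [|c [cc uc /andP[c3 cs] sub]] :=
    nobacktrack_cycle uadj_irr (covering_path ws) (covering_nobacktrack ws ns).
  rewrite cons_uniq negb_and negbK; apply/orP; left.
  have -> : phi x = last (phi z) (map phi s) by rewrite last_map xy -ls.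
  exact: (mem_last (phi z) (map phi s)).
have [|u uc' eu] := @cycle_entangled (2 * r.+1) c cc uc.
  rewrite c3; apply: leq_trans cs _; rewrite size_map; apply: leq_trans ss _.
  by rewrite size_cat; lia.
have inB w : w \in phi x :: map phi (z :: s) -> exists2 v, B v & w = phi v.
  rewrite inE => /orP[/eqP->|]; first by exists x.
  elim: (z :: s) x ws {Bx xy ss wp wpq lp cs ns ls sub uc'} => //= v t IH x' [[_ _ Bv] wt].
  by rewrite inE => /orP[/eqP->|/(IH _ wt)//]; exists v.
have [v Bv uE] := inB _ (sub _ uc').
by have := not_entangled Bv; rewrite -uE eu.
Qed.

Lemma gball_sub x : gball r a x -> B x.
Proof. exact: gball_mono. Qed.

(** The mark fixes the degree of [phi x], and the images of the neighbours of [x] are distinct and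
    numerous enough to exhaust it. The margin from r to r + 1 keeps these neighbours in the ball. *)
Lemma covering_surj x w : gball r a x -> uadj (phi x) w ->
  exists y, [/\ hadj x y, B y & w = phi y].
Proof.
move=> rx; have Bx := gball_sub rx; have dx := phi_degree Bx.
have Bout y : edge x y -> B y by move=> xy; apply: gball_step rx _; left.
have Bin y : edge y x -> B y by move=> xy; apply: gball_step rx _; right.
rewrite /uadj /=; case mx : (mark x) dx => -[din dout].
- by case: (no_root mx).
- have [y1 [y2 [y3 [yx xy2 xy3 m2 m3]]]] := tree_nbrs mx.
  case/orP => arc; last first.
    exists y1; split; [by right|exact: Bin|apply: indeg1_inj din arc _].
    by apply: phi_edge => //; apply: Bin.
  have [] := @outdeg2_cover _ _ N _ (phi y2) (phi y3) w dout.
  + apply/eqP => E; have := phi_mark (Bout _ xy2).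
    by rewrite E (phi_mark (Bout _ xy3)) m2 m3.
  + by apply: phi_edge => //; apply: Bout.
  + by apply: phi_edge => //; apply: Bout.
  + by [].
  + by move=> ->; exists y2; split; [left|apply: Bout|].
  + by move=> ->; exists y3; split; [left|apply: Bout|].
- have [y1 [y2 [y3 [yx1 yx2 xy _ dif]]]] := ret_nbrs mx.
  case/orP => arc.
    exists y3; split; [by left|exact: Bout|apply: outdeg1_inj dout arc _].
    by apply: phi_edge => //; apply: Bout.
  have [] := @indeg2_cover _ _ N _ (phi y1) (phi y2) w din.
  + by apply/eqP; apply: dif; apply: Bin.
  + by apply: phi_edge => //; apply: Bin.
  + by apply: phi_edge => //; apply: Bin.
  + by [].
  + by move=> ->; exists y1; split; [right|apply: Bin|].
  + by move=> ->; exists y2; split; [right|apply: Bin|].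
- have [y yx] := leaf_nbr mx.
  rewrite (negbTE (outdeg0 _ dout)) /= => arc.
  exists y; split; [by right|exact: Bin|apply: indeg1_inj din arc _].
  by apply: phi_edge => //; apply: Bin.
Qed.

Let NG := mgraph_of N.

Lemma covering_ball k x : (k <= r.+1)%N -> gball k a x -> @gball NG k (phi a) (phi x).
Proof.
elim: k x => [|k IH] x kr /=; first by move=> ->.
move=> [w wk xw].
have Bw : B w by apply: gball_mono wk; apply: ltnW.
have Bx : B x by apply: (@gball_mono _ _ k.+1) => //; exists w.
exists (phi w); first by apply: IH => //; apply: ltnW.
by case: xw => [->|wx|xw]; [exact: Or31|apply: Or32|apply: Or33]; exact: phi_edge.
Qed.

Lemma covering_ball_lift k w : (k <= r)%N -> @gball NG k (phi a) w ->
  exists2 x, gball k a x & w = phi x.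
Proof.
elim: k w => [|k IH] w kr /=; first by move=> ->; exists a.
move=> [w' /(IH _ (ltnW kr))[x xk ->] wx].
have rx : gball r a x by apply: gball_mono xk; apply: ltnW.
case: wx => [->|wx|xw].
- by exists x => //; exists x => //; apply: Or31.
- have [|y [xy By ->]] := @covering_surj x w rx; first by apply/orP; left.
  by exists y => //; exists x => //; case: xy; [apply: Or32|apply: Or33].
- have [|y [xy By ->]] := @covering_surj x w rx; first by apply/orP; right.
  by exists y => //; exists x => //; case: xy; [apply: Or32|apply: Or33].
Qed.

(** The arc lifts to an edge at [x] whose other end is [y] by injectivity; the reverse orientation
    would give opposite arcs in the network. *)
Lemma covering_edge_reflect x y : gball r a x -> gball r a y ->
  darc N (phi x) (phi y) -> edge x y.
Proof.
move=> rx ry xy; have [|z [xz Bz E]] := @covering_surj x (phi y) rx.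
  by rewrite /uadj /= xy.
have -> := covering_inj (gball_sub ry) Bz E.
case: xz => // zx; have := phi_edge Bz (gball_sub rx) zx.
by rewrite -E => /darc_asym; rewrite xy.
Qed.

Lemma covering_iso : rooted_iso (nbhd_at r a) (@nbhd_at NG r (phi a)).
Proof.
have fin (x : nbhd_graph r a) : phi (val x) \in (@gball NG r (phi a)).
  by apply: mem_set; apply: covering_ball => //; apply: set_mem (valP x).
pose f (x : nbhd_graph r a) : nbhd_graph r (phi a : NG) := exist _ (phi (val x)) (fin x).
have finj x y : f x = f y -> x = y.
  move=> /(congr1 val)/= E; apply: val_inj; apply: covering_inj E.
    by apply: gball_sub; apply: set_mem (valP x).
  by apply: gball_sub; apply: set_mem (valP y).
have /choice[g gP] : forall y, exists x, f x = y.
  move=> [w wr]; have [|x xr E] := @covering_ball_lift r w (leqnn r).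
    exact: set_mem wr.
  by exists (exist _ x (mem_set xr)); apply: val_inj => /=.
exists f; split.
- exists g => // x; apply: finj; exact: gP.
- exact: val_inj.
- by move=> x; apply: phi_mark; apply: gball_sub; apply: set_mem (valP x).
- move=> x y; split.
    by apply: covering_edge_reflect; apply: set_mem; [apply: valP x|apply: valP y].
  by apply: phi_edge; apply: gball_sub; apply: set_mem; [apply: valP x|apply: valP y].
Qed.

End Covering.

End LocalIsomorphism.

(** * Switching *)

Lemma card_triple (A B C : finType) (P : A -> B -> C -> bool) :
  #|[set t : A * B * C | P t.1.1 t.1.2 t.2]%SET| = (\sum_a \sum_b #|[set c | P a b c]%SET|)%N.
Proof.
rewrite pair_bigA /=; under eq_bigr => p _ do rewrite -sum1dep_card.
rewrite pair_big_dep /= -sum1dep_card.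
by apply: eq_bigl => -[[a b] c].
Qed.

Section Switch.
Variables (n : nat) (V : finType).

(* Exchanges the reticulation children of u and v. *)
Definition switch (N : lgraph n V) (u v : V) : lgraph n V :=
  ([set p | darc N (if is_ret N p.2 then tperm u v p.1 else p.1) p.2]%SET, N.2).

Lemma darc_switch N u v x y :
  darc (switch N u v) x y = darc N (if is_ret N y then tperm u v x else x) y.
Proof. by rewrite {1}/darc inE. Qed.

Section Valid.
Variables (N : lgraph n V) (u v : V).
Hypotheses (stcN : simplex_tree_child N) (uu : unary N u) (uv : unary N v).
Let N' := switch N u v.

Lemma indeg_switch y : indeg N' y = indeg N y.
Proof.
rewrite /indeg; case ry : (is_ret N y); last first.
  by apply: eq_card => x; rewrite !inE darc_switch ry.
rewrite -[RHS](card_preimset _ (@perm_inj _ (tperm u v))).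
by apply: eq_card => x; rewrite !inE darc_switch ry.
Qed.

Lemma tperm_unary x : unary N (tperm u v x) = unary N x.
Proof. by case: tpermP => [->|->|//]; rewrite uu uv. Qed.

Lemma card_ret_children x : #|[set y | is_ret N y && darc N x y]%SET| = unary N x.
Proof.
apply/eqP; rewrite eqn_leq; apply/andP; split.
  rewrite cardsE; apply: count_le_one => y z /andP[ry xy] /andP[rz xz].
  exact: ret_child_inj ry rz xy xz.
case ux : (unary N x) => //; case/existsP: ux => c rc; rewrite card_gt0.
by apply/set0Pn; exists c; rewrite inE.
Qed.

(** Children that are not reticulations are untouched, and both [u] and [v] have exactly one
    reticulation child. *)
Lemma outdeg_switch x : outdeg N' x = outdeg N x.
Proof.
rewrite /outdeg -!(cardsID [set y | is_ret N y]%SET [set y | darc _ _ y]%SET).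
congr (_ + _)%N; last first.
  by apply: eq_card => y; rewrite !inE darc_switch; case: (is_ret N y).
transitivity (unary N (tperm u v x) : nat); last rewrite tperm_unary.
  rewrite -card_ret_children; apply: eq_card => y; rewrite !inE darc_switch andbC.
  by case: (is_ret N y).
by rewrite -card_ret_children; apply: eq_card => y; rewrite !inE andbC.
Qed.

Lemma degree_switch x : degree N' x = degree N x.
Proof. by rewrite /degree indeg_switch outdeg_switch. Qed.

Lemma is_ret_switch x : is_ret N' x = is_ret N x.
Proof. by rewrite /is_ret degree_switch. Qed.

Lemma is_leaf_switch x : is_leaf N' x = is_leaf N x.
Proof. by rewrite /is_leaf degree_switch. Qed.

Lemma is_tree_switch x : is_tree N' x = is_tree N x.
Proof. by rewrite /is_tree degree_switch. Qed.

Lemma switchK : switch N' u v = N.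
Proof.
rewrite [RHS]surjective_pairing; congr (_, _); apply/setP => -[x y].
rewrite inE darc_switch is_ret_switch /= -[RHS]/(darc N x y).
by case: (is_ret N y); rewrite ?tpermK.
Qed.

Lemma ret_switch_parent x y : is_ret N y -> darc N' x y -> is_tree N x.
Proof.
move=> ry; rewrite darc_switch ry => /(ret_parent stcN ry).
by case: tpermP => [-> _|-> _|//]; apply: unary_tree.
Qed.

Lemma switch_stc : simplex_tree_child N'.
Proof.
have [ o [od typ]] := stc_rootP stcN.
(* Only arcs from tree vertices to reticulations move. With reticulations above all tree vertices
   and leaves above these, any such arc increases the rank. *)
pose rk x := if is_ret N x then #|V|.+1 else if is_leaf N x then #|V|.+2 else ancestors N x.
have anc x : (ancestors N x <= #|V|)%N by exact: max_card.
apply: (@simplex_of_rank _ _ _ rk o).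
- move=> x y; have [ry xy|/negbTE ry] := boolP (is_ret N y).
    have tx := ret_switch_parent ry xy.
    by rewrite /rk ry /is_ret /is_leaf (eqP tx) /= ltnS.
  rewrite darc_switch ry => xy; rewrite /rk ry.
  have -> : is_leaf N x = false by apply/negbTE; apply: contraL xy; apply: leaf_out.
  case rx : (is_ret N x); first by rewrite (ret_child stcN rx xy).
  case: ifP => _; last exact: darc_ancestors.
  by rewrite ltnS; apply: leqW.
- by rewrite degree_switch.
- by move=> x /typ; rewrite is_leaf_switch is_tree_switch is_ret_switch.
- case/and5P: stcN => _ _ /andP[inj /forallP lf] _ _; apply/andP; split=> //.
  by apply/forallP => x; rewrite is_leaf_switch; apply: lf.
- apply/forallP => x; apply/implyP; rewrite is_leaf_switch => /(tree_childP stcN)[w xw tw].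
  apply/existsP; exists w; rewrite is_leaf_switch is_tree_switch tw andbT darc_switch.
  have -> // : is_ret N w = false.
  by move: tw; rewrite /is_tree /is_leaf /is_ret => /orP[]/eqP->.
- apply/forallP => x; apply/forallP => w; apply/implyP.
  rewrite is_ret_switch is_leaf_switch => /andP[rx xw].
  case rw : (is_ret N w).
    by have := ret_switch_parent rw xw; rewrite /is_tree (eqP rx).
  by move: xw; rewrite darc_switch rw; apply: ret_child.
Qed.

(** The path from [u] to the other parent [u'] of [c] avoids [c], and avoids [v] by distance, so
    none of its arcs moves. After the switch [v] is a parent of [c], and two more steps lead from
    [u'] through [c] to [v]. *)
Lemma entangled_switch L : entangled N L u -> v \notin hood (uadj N) L [set u]%SET ->
  v \in hood (uadj N') L.+2 [set u]%SET.
Proof.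
case/existsP => c /existsP[u' /and5P[rc uc uc' uu' u'L]] vL.
have sub l : hood (avoid N c) l [set u]%SET \subset hood (uadj N) l [set u]%SET.
  elim: l => [|l IH]; first exact: fintype.subxx.
  rewrite /hood !iterS; apply: thicken_mono IH => x y; rewrite /avoid /=.
  by case/and3P.
have nv l x : (l <= L)%N -> x \in hood (avoid N c) l [set u]%SET -> x != v.
  move=> lL xl; apply: contraNneq vL => <-.
  by apply: (fintype.subsetP (hood_mono _ _ lL)); apply: (fintype.subsetP (sub l)).
have arc x y : x != v -> y != c -> darc N x y -> darc N' x y.
  move=> xv yc xy; rewrite darc_switch; case ry : (is_ret N y) => //.
  case: tpermP => [xu|xv'|//]; last by rewrite xv' eqxx in xv.
  by case/eqP: yc; apply: (ret_child_inj stcN ry rc _ uc); rewrite -xu.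
have step l : (l <= L)%N -> hood (avoid N c) l [set u]%SET \subset hood (uadj N') l [set u]%SET.
  elim: l => [|l IH] lL; first exact: fintype.subxx.
  apply/fintype.subsetP => y yl; have yv := nv _ _ lL yl; move: yl.
  rewrite /hood !iterS 2!inE => /orP[|/existsP[x /andP[xl]]].
    move=> /(fintype.subsetP (IH (ltnW lL))) yl.
    exact: (fintype.subsetP (thicken_sub _ _)).
  rewrite /avoid /= => /and3P[xy xc yc].
  have xv := nv _ _ (ltnW lL) xl.
  apply: thickenP (fintype.subsetP (IH (ltnW lL)) _ xl) _.
  by rewrite /uadj /=; case/orP: xy => xy; apply/orP; [left|right]; apply: arc.
have u'v := nv _ _ (leqnn L) u'L.
have u'N := fintype.subsetP (step L (leqnn L)) _ u'L.
have uc'N : darc N' u' c by rewrite darc_switch rc tpermD // eq_sym.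
have vcN : darc N' v c by rewrite darc_switch rc tpermR.
rewrite /hood !iterS; apply: (@thickenP _ _ _ c); last by rewrite /uadj /= vcN orbT.
by apply: (@thickenP _ _ _ u') => //; rewrite /uadj /= uc'N.
Qed.

End Valid.

Definition networks : {set lgraph n V} := [set N | simplex_tree_child N]%SET.

Lemma entangled_unary (N : lgraph n V) L u : entangled N L u -> unary N u.
Proof.
by case/existsP => c /existsP[u' /and5P[rc uc _ _ _]]; apply/existsP; exists c; rewrite rc.
Qed.

Definition entanglement L (N : lgraph n V) : nat := #|[set u | entangled N L u]%SET|.

(** Triples (network, entangled [u], unary [v] far from [u]) are sent by the switch to triples with
    [v] within L + 2 of [u]. The map is injective because switching again undoes it. Degrees are at
    most 3, so balls of radius l have at most 4^l vertices. *)
Lemma sum_entanglement L :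
  (\sum_(N in networks) entanglement L N * (#|V| - 2 * n - 4 ^ L) <=
   #|networks| * (#|V| * 4 ^ L.+2))%N.
Proof.
pose P (N : lgraph n V) u v := [&& N \in networks, entangled N L u, unary N v
  & v \notin hood (uadj N) L [set u]%SET].
pose Q (N : lgraph n V) u v := (N \in networks) && (v \in hood (uadj N) L.+2 [set u]%SET).
pose f (t : lgraph n V * V * V) := (switch t.1.1 t.1.2 t.2, t.1.2, t.2).
have card1 (x : V) : #|[set x]%SET| = 1%N by rewrite cards1.
have fP : f @: [set t | P t.1.1 t.1.2 t.2]%SET \subset [set t | Q t.1.1 t.1.2 t.2]%SET.
  apply/fintype.subsetP => _ /imsetP[[[N u] v] + ->].
  rewrite inE /P /= => /and4P[NS eu uv vL]; have stcN : simplex_tree_child N by rewrite inE in NS.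
  rewrite inE /Q /=; apply/andP; split; last exact: entangled_switch.
  by rewrite inE; apply: switch_stc (entangled_unary eu) uv.
have finj : {in [set t | P t.1.1 t.1.2 t.2]%SET &, injective f}.
  move=> [[N u] v] [[M u1] v1]; rewrite inE /P /= => /and4P[stcN eu uv _].
  rewrite inE /P /= => /and4P[stcM eu1 uv1 _].
  rewrite /f /= => /pair_equal_spec[/pair_equal_spec[E uE] vE].
  subst u1 v1; rewrite !inE in stcN stcM.
  rewrite -(switchK stcN (entangled_unary eu) uv) E.
  by rewrite (switchK stcM (entangled_unary eu1) uv1).
have := subset_leq_card fP; rewrite card_in_imset // (card_triple P) (card_triple Q) => le.
apply: leq_trans (leq_trans le _); last first.
  rewrite -sum_nat_const [leqRHS]big_mkcond /=; apply: leq_sum => N _.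
  have [NS|NS] := boolP (N \in networks); last first.
    rewrite big1 // => u _; apply/eqP; rewrite cards_eq0; apply/eqP/setP => v.
    by rewrite !inE /Q (negbTE NS).
  have stcN : simplex_tree_child N by rewrite inE in NS.
  rewrite -sum_nat_const; apply: leq_sum => u _.
  have := card_hood L.+2 [set u]%SET (card_uadj stcN); rewrite card1 muln1.
  apply: leq_trans; apply: subset_leq_card; apply/fintype.subsetP => v.
  by rewrite inE /Q NS.
rewrite [leqLHS]big_mkcond /=; apply: leq_sum => N _.
have [NS|NS] := boolP (N \in networks) => //.
have stcN : simplex_tree_child N by rewrite inE in NS.
rewrite /entanglement -sum_nat_const [leqLHS]big_mkcond /=; apply: leq_sum => u _.
rewrite inE; case: ifP => // eu.
(* Here |V| - 2n is 2k, a lower bound for the number of unary vertices, of which at most 4^L are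
   near [u]. *)
rewrite leq_subLR (card_vert stcN) addKn.
apply: leq_trans (card_unary stcN) _.
apply: (@leq_trans #|hood (uadj N) L [set u]%SET :|: [set c | P N u c]%SET|%SET).
  apply: subset_leq_card; apply/fintype.subsetP => v; rewrite inE => uv.
  by rewrite finset.in_setU [in X in _ || X]inE /P NS eu uv /=; case: (v \in _).
apply: leq_trans (leq_card_setU _ _) _; rewrite leq_add2r.
by have := card_hood L [set u]%SET (card_uadj stcN); rewrite card1 muln1.
Qed.

End Switch.

(** * Labelled networks and isomorphism classes *)

Section Relabel.
Variables (n : nat) (V W : finType).

Definition relabel (f : V -> W) (N : lgraph n V) : lgraph n W :=
  ([set (f p.1, f p.2) | p in N.1]%SET, [ffun i => f (N.2 i)]).

Lemma darc_relabel f N x y : injective f -> darc (relabel f N) (f x) (f y) = darc N x y.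
Proof.
move=> finj; apply/imsetP/idP => [[[u v] uv [/finj-> /finj->]]|xy]; first exact: uv.
by exists (x, y).
Qed.

Lemma degree_relabel f N x : bijective f -> degree (relabel f N) (f x) = degree N x.
Proof.
move=> fb; have finj := bij_inj fb; rewrite /degree /indeg /outdeg.
congr (_, _); rewrite -(on_card_preimset (f := f)); try exact: onW_bij.
  by apply: eq_card => u; rewrite !inE darc_relabel.
by apply: eq_card => u; rewrite !inE darc_relabel.
Qed.

Lemma relabel_stc f N : bijective f -> simplex_tree_child N -> simplex_tree_child (relabel f N).
Proof.
move=> fb stcN; have finj := bij_inj fb; have [g fK gK] := fb.
have [ o [od typ]] := stc_rootP stcN.
have dg w : degree (relabel f N) w = degree N (g w) by rewrite -{1}(gK w) degree_relabel.
have arc w z : darc (relabel f N) w z = darc N (g w) (g z).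
  by rewrite -{1}(gK w) -{1}(gK z) darc_relabel.
have lE w : is_leaf (relabel f N) w = is_leaf N (g w) by rewrite /is_leaf dg.
have tE w : is_tree (relabel f N) w = is_tree N (g w) by rewrite /is_tree dg.
have rE w : is_ret (relabel f N) w = is_ret N (g w) by rewrite /is_ret dg.
apply: (@simplex_of_rank _ _ _ (fun w => ancestors N (g w)) (f o)).
- by move=> x y; rewrite arc; apply: darc_ancestors.
- by rewrite dg fK.
- move=> w wo; rewrite lE tE rE; apply: typ; apply: contraNneq wo => <-.
  by rewrite gK.
- apply/andP; split.
    by apply/injectiveP => i j; rewrite !ffunE => /finj/(label_inj stcN).
  apply/forallP => w; rewrite lE; apply/eqP; apply/idP/idP => [/codomP[i ->]|/(leafP stcN)[i gw]].
    by rewrite ffunE fK; apply/(leafP stcN); exists i.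
  by apply/codomP; exists i; rewrite ffunE -gw gK.
- apply/forallP => w; apply/implyP; rewrite lE => /(tree_childP stcN)[z wz tz].
  by apply/existsP; exists (f z); rewrite arc lE tE fK wz tz.
- apply/forallP => w; apply/forallP => z; apply/implyP; rewrite rE lE arc => /andP[].
  exact: ret_child.
Qed.

End Relabel.

(* Going up along the tree arcs from the labelled leaves determines every vertex. *)
Lemma morphism_rigid n (V : finType) (N N' : lgraph n V) (f : V -> V) :
  simplex_tree_child N -> 
  (forall x y, darc N x y -> darc N' (f x) (f y)) ->
  (forall i, f (N.2 i) = N.2 i) ->
  (forall x w, darc N x w -> is_tree N w || is_leaf N w ->
     darc N' x w /\ indeg N' w = 1%N) ->
  f =1 id.
Proof.
move=> stcN fhom flab tree x.
have [m] := ubnP (#|V| - ancestors N x)%N; elim: m x => // m IH x xm.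
have [/(leafP stcN)[i ->]|nl] := boolP (is_leaf N x); first exact: flab.
have [w xw tw] := tree_childP stcN nl; have [xw' iw] := tree _ _ xw tw.
have fw : f w = w.
  apply: IH; have := darc_ancestors stcN xw.
  have : (ancestors N w <= #|V|)%N by exact: max_card.
  lia.
by apply: indeg1_inj iw _ xw'; rewrite -[X in darc _ _ X]fw; apply: fhom.
Qed.

(** * Sizes of labelling classes *)

Section Classes.
Variable n : nat.

Definition labelled (M : nat) : finType := {N : lgraph n 'I_M | simplex_tree_child N}.

Definition cnet M (N : labelled M) : cnetwork n := existT _ M N.

Definition class_of M (N : labelled M) : network n := \pi_(network n) (cnet N).

Lemma network_class_eqP (C D : cnetwork n) :
  reflect (network_iso C D) (\pi_(network n) C == \pi_(network n) D).
Proof. by rewrite eqmodE /= /network_isob; apply: asboolP. Qed.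

Lemma repr_class_iso M (N : labelled M) : network_iso (repr (class_of N)) (cnet N).
Proof. by apply/network_class_eqP; rewrite reprK. Qed.

Lemma network_iso_size (C D : cnetwork n) : network_iso C D -> tag C = tag D.
Proof. by move=> [f [/bij_eq_card + _ _]]; rewrite !card_ord. Qed.

Definition permute M (s : 'S_M) (N : labelled M) : labelled M :=
  exist _ (relabel s (val N)) (relabel_stc (Bijective (permK s) (permKV s)) (valP N)).

(** Two permutations with the same result differ by an automorphism fixing the leaf labels, trivial
    by [morphism_rigid]. *)
Lemma permute_inj M (N : labelled M) : injective (fun s : {perm 'I_M} => @permute M s N).
Proof.
move=> s t /(congr1 val)/= E; apply/permP => x.
have H := @morphism_rigid n _ (val N) (val N) (fun x => (t^-1)%g (s x)) (valP N).
apply: (can_inj (permK t^-1)%g); rewrite permK H //.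
- move=> y z yz; rewrite -(darc_relabel _ _ _ (@perm_inj _ t)) !permKV -E.
  by rewrite darc_relabel //; apply: perm_inj.
- move=> i; have /(congr1 (fun L : lgraph n 'I_M => L.2 i)) := E.
  by rewrite /= !ffunE => ->; rewrite permK.
- by move=> y w yw /orP[]/eqP[? _].
Qed.

(** The class is an orbit of the symmetric group on the M vertices, which acts freely by
    [permute_inj]. *)
Lemma card_class M (N : labelled M) :
  #|[set N' : labelled M | class_of N' == class_of N]%SET| = (M`!)%N.
Proof.
rewrite -card_Sn.
rewrite -[RHS](card_imset _ (@permute_inj M N)).
apply: eq_card => N'; rewrite inE; apply/network_class_eqP/imsetP.
  move=> /network_iso_sym[f [fb fe fl]]; have finj := bij_inj fb.
  exists (perm finj) => //; apply: val_inj => /=.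
  rewrite [LHS]surjective_pairing; congr (_, _).
    apply/setP => -[x y]; have [g fK gK] := fb.
    rewrite -(gK x) -(gK y); have := darc_relabel (val N) (g x) (g y) (@perm_inj _ (perm finj)).
    rewrite !permE => rel; have := fe (g x) (g y); rewrite /clgraph /= => fe'.
    by rewrite -[LHS]/(darc _ _ _) fe' -rel.
  by apply/ffunP => i; rewrite ffunE permE -fl.
move=> [s _ ->]; apply: network_iso_sym; exists s; split; first exact: Bijective (permK s) (permKV s).
  by move=> u v; rewrite /clgraph /= darc_relabel //; apply: perm_inj.
by move=> i; rewrite /clgraph /= ffunE.
Qed.

Definition of_size (A : {set network n}) M : {set network n} :=
  [set c in A | tag (repr c) == M]%SET.

Lemma card_of_size (A : {set network n}) M :
  #|[set N : labelled M | class_of N \in A]%SET| = (#|of_size A M| * M`!)%N.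
Proof.
set S := [set N | _]%SET.
rewrite -sum1_card (partition_big_imset (@class_of M)) /=.
have -> : class_of (M := M) @: S = of_size A M.
  apply/setP => c; rewrite inE; apply/imsetP/andP.
    by case=> N; rewrite inE => cA ->; rewrite cA (network_iso_size (repr_class_iso N)).
  move=> [cA /eqP]; move: cA; rewrite -{1 3}(reprK c); case: (repr c) => m N /= cA mM.
  by subst m; exists N; rewrite ?inE.
rewrite -sum_nat_const; apply: eq_bigr => c; rewrite inE => /andP[cA /eqP].
move: cA; rewrite -{1 3}(reprK c); case: (repr c) => m N /= cA mM; subst m.
rewrite sum1_card -[RHS](card_class N); apply: eq_card => N'.
rewrite unfold_in !inE -[\pi_(_) _]/(class_of N); case: eqP => [E|_]; last by rewrite !andbF.
by rewrite E andbT.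
Qed.

Lemma card_by_size (A : {set network n}) :
  #|A| = (\sum_(M < (4 * n).+1) #|of_size A M|)%N.
Proof.
have lt (c : network n) : (tag (repr c) < (4 * n).+1)%N.
  by rewrite ltnS -[X in (X <= _)%N]card_ord; apply: card_vertices (valP (tagged (repr c))).
rewrite -sum1_card (partition_big (fun c => Ordinal (lt c)) xpredT) //=.
by apply: eq_bigr => M _; rewrite -sum1_card; apply: eq_bigl => c; rewrite inE.
Qed.

End Classes.

(** * Caterpillars *)

Section Caterpillar.
Variable k : nat.

(** The left summand is a path from the root at 0 to a leaf at 2k + 1; [inr (j, false)] is a
    reticulation and [inr (j, true)] the leaf below it. *)
Definition cat_vertex : finType := ('I_(k + k).+2 + 'I_k * bool)%type.

Section Graph.
Variables s t : 'S_k.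

(** Reticulation [j] has one parent in the upper half of the path, placed by [s], and one in the
    lower half, placed by [t]. *)
Definition on_spine (j : 'I_k) (i : nat) : bool := (i == (s j).+1) || (i == (k + t j).+1).

Definition cat_arc (x y : cat_vertex) : bool :=
  match x, y with
  | inl i, inl j => j == i.+1 :> nat
  | inl i, inr (j, false) => on_spine j i
  | inr (j, false), inr (j', true) => j == j'
  | _, _ => false
  end.

Definition caterpillar : lgraph k.+1 cat_vertex :=
  ([set p | cat_arc p.1 p.2]%SET,
   [ffun i => if unlift ord_max i is Some j then inr (j, true) else inl ord_max]).

Lemma darc_cat x y : darc caterpillar x y = cat_arc x y.
Proof. by rewrite /darc inE. Qed.

(** Positions 1 to k are matched by the inverse of [s], positions k + 1 to 2k by that of [t]; so
    each inner vertex gets exactly one reticulation child. *)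
Lemma on_spineP i : (0 < i <= k + k)%N -> exists r, forall j, on_spine j i = (j == r).
Proof.
move=> /andP[i0 ik]; case: (leqP i k) => ik'.
  have lt : (i.-1 < k)%N by lia.
  exists ((s^-1)%g (Ordinal lt)) => j; rewrite /on_spine.
  have -> : (i == (k + t j).+1) = false by lia.
  rewrite orbF -(inj_eq (@perm_inj _ s)) permKV -val_eqE /=; lia.
have lt : (i.-1 - k < k)%N by lia.
exists ((t^-1)%g (Ordinal lt)) => j; rewrite /on_spine.
have -> : (i == (s j).+1) = false by have := ltn_ord (s j); lia.
rewrite -(inj_eq (@perm_inj _ t)) permKV -val_eqE /=; lia.
Qed.

Lemma on_spine_range j i : on_spine j i -> (0 < i <= k + k)%N.
Proof. by rewrite /on_spine; have := ltn_ord (s j); have := ltn_ord (t j); lia. Qed.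

Definition cat_degree (x : cat_vertex) : nat * nat :=
  match x with
  | inl i => ((0 < i)%N : nat, (i <= k + k) + (0 < i <= k + k))%N
  | inr (_, b) => if b then (1, 0)%N else (2, 1)%N
  end.

Lemma inl_eq (i j : 'I_(k + k).+2) : (inl i == inl j :> cat_vertex) = (i == j :> nat).
Proof. by []. Qed.

Lemma inr_eq (p q : 'I_k * bool) : (inr p == inr q :> cat_vertex) = (p == q).
Proof. by []. Qed.

Lemma indeg_cat x : indeg caterpillar x = (cat_degree x).1.
Proof.
rewrite /indeg; case: x => [i|[j []]] /=.
- case: (posnP i) => i0.
    apply/eqP; rewrite cards_eq0; apply/eqP/setP => y; rewrite !inE darc_cat.
    by case: y => [j|[j []]] //=; rewrite i0.
  transitivity #|[set (inl (inord i.-1) : cat_vertex)]%SET|; last by rewrite cards1.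
  apply: eq_card => y; rewrite !inE darc_cat; case: y => [j|[j []]] //=.
  by have il := ltn_ord i; rewrite inl_eq inordK; lia.
- transitivity #|[set (inr (j, false) : cat_vertex)]%SET|; last by rewrite cards1.
  apply: eq_card => y; rewrite !inE darc_cat; case: y => [i|[i []]] //=.
    by rewrite inr_eq xpair_eqE andbF.
  by rewrite inr_eq xpair_eqE andbT.
- have := ltn_ord (s j); have := ltn_ord (t j) => tj sj.
  transitivity #|[set (inl (inord (s j).+1) : cat_vertex); inl (inord (k + t j).+1)]%SET|.
    apply: eq_card => y; rewrite !inE darc_cat; case: y => [i|[i []]] //=.
    by rewrite !inl_eq !inordK //; lia.
  by rewrite cards2 inl_eq !inordK; lia.
Qed.

Lemma outdeg_cat x : outdeg caterpillar x = (cat_degree x).2.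
Proof.
rewrite /outdeg; case: x => [i|[j []]] /=.
- case: (leqP i (k + k)) => ik; last first.
    rewrite andbF; apply/eqP; rewrite cards_eq0; apply/eqP/setP => y; rewrite !inE darc_cat.
    case: y => [j|[j []]] //=; first by have := ltn_ord j; lia.
    by apply/negbTE/negP => /on_spine_range; lia.
  case: (posnP i) => i0 /=.
    transitivity #|[set (inl (inord 1) : cat_vertex)]%SET|; last by rewrite cards1.
    apply: eq_card => y; rewrite !inE darc_cat; case: y => [j|[j []]] //=.
      by rewrite inl_eq inordK // i0.
    by apply/negbTE/negP => /on_spine_range; rewrite i0.
  have [|r rP] := @on_spineP i; first by rewrite i0.
  transitivity #|[set (inl (inord i.+1) : cat_vertex); inr (r, false)]%SET|; last first.
    by rewrite cards2.
  apply: eq_card => y; rewrite !inE darc_cat; case: y => [j|[j []]] //=.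
  + by rewrite orbF inl_eq inordK.
  + by rewrite inr_eq xpair_eqE andbF.
  + by rewrite inr_eq xpair_eqE andbT rP.
- apply/eqP; rewrite cards_eq0; apply/eqP/setP => y; rewrite !inE darc_cat.
  by case: y => [i|[i []]].
- transitivity #|[set (inr (j, true) : cat_vertex)]%SET|; last by rewrite cards1.
  apply: eq_card => y; rewrite !inE darc_cat; case: y => [i|[i []]] //=.
    by rewrite inr_eq xpair_eqE andbT eq_sym.
  by rewrite inr_eq xpair_eqE andbF.
Qed.

Lemma degree_cat x : degree caterpillar x = cat_degree x.
Proof. by rewrite /degree indeg_cat outdeg_cat -surjective_pairing. Qed.

Lemma leaf_cat x : is_leaf caterpillar x =
  match x with inl i => i == ord_max | inr (_, b) => b end.
Proof.
rewrite /is_leaf degree_cat; case: x => [i|[j []]] //=.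
rewrite -val_eqE /= xpair_eqE; have := ltn_ord i; lia.
Qed.

Lemma ret_cat x : is_ret caterpillar x = if x is inr (_, b) then ~~ b else false.
Proof.
rewrite /is_ret degree_cat; case: x => [i|[j []]] //=.
by rewrite xpair_eqE; case: (0 < i)%N.
Qed.

Lemma tree_cat i : (0 < i <= k + k)%N -> is_tree caterpillar (inl (inord i)).
Proof. by move=> ik; rewrite /is_tree degree_cat /= inordK; [case/andP: ik => -> ->|lia]. Qed.

Lemma caterpillar_stc : simplex_tree_child caterpillar.
Proof.
pose rk (x : cat_vertex) := match x with
  | inl i => nat_of_ord i | inr (_, b) => if b then (k + k).+3 else (k + k).+2 end.
apply: (@simplex_of_rank _ _ _ rk (inl ord0)).
- move=> x y; rewrite darc_cat; case: x y => [i|[i []]] [j|[j []]] //=.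
  by move=> /eqP->.
- by rewrite degree_cat.
- case=> [i|[j []]]; rewrite leaf_cat ret_cat ?orbT // inl_eq => i0.
  case: eqVneq => //= im; rewrite -(inord_val i) tree_cat //.
  by move: im i0; rewrite -val_eqE /=; have := ltn_ord i; lia.
- apply/andP; split.
    apply/injectiveP => i j; rewrite !ffunE.
    by case: unliftP => [i' ->|->]; case: unliftP => [j' ->|->] // [->].
  apply/forallP => x; rewrite leaf_cat; apply/eqP; apply/idP/idP.
    by case/codomP => i ->; rewrite ffunE; case: unliftP.
  case: x => [i /eqP->|[j []] // _]; apply/codomP.
    by exists ord_max; rewrite ffunE unlift_none.
  by exists (lift ord_max j); rewrite ffunE liftK.
- apply/forallP => x; apply/implyP; rewrite leaf_cat; case: x => [i|[j []]] //.
    rewrite -val_eqE /= => im; apply/existsP; exists (inl (inord i.+1)).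
    have iS : (i.+1 < (k + k).+2)%N by have := ltn_ord i; lia.
    rewrite darc_cat /= inordK // eqxx leaf_cat.
    case: (leqP i.+1 (k + k)) => ik; first by rewrite tree_cat.
    by rewrite -val_eqE /= inordK // orbC; have := ltn_ord i; lia.
  by move=> _; apply/existsP; exists (inr (j, true)); rewrite darc_cat leaf_cat /= eqxx orbT.
- apply/forallP => x; apply/forallP => y; apply/implyP; rewrite ret_cat leaf_cat darc_cat.
  by case: x y => [i|[i []]] [j|[j []]].
Qed.

End Graph.

Definition caterpillar_class (p : 'S_k * 'S_k) : network k.+1 :=
  class_of (exist _ (relabel enum_rank (caterpillar p.1 p.2))
    (relabel_stc (@enum_rank_bij _) (caterpillar_stc p.1 p.2))).

(** The labels sit on the same vertices and the arcs into non-reticulations are the same in all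
    caterpillars, so an isomorphism is the identity by [morphism_rigid]. The parents of each
    reticulation then give back [s] and [t]. *)
Lemma caterpillar_class_inj : injective caterpillar_class.
Proof.
move=> [s t] [s' t'] /eqP/network_class_eqP[f [fb fe fl]].
rewrite /cnet /clgraph /= in f fb fe fl.
pose g (x : cat_vertex) : cat_vertex := enum_val (f (enum_rank x)).
have arc x y : darc (caterpillar s' t') (g x) (g y) = darc (caterpillar s t) x y.
  rewrite -(darc_relabel _ _ _ enum_rank_inj) !enum_valK fe.
  by rewrite darc_relabel //; apply: enum_rank_inj.
have gid : g =1 id.
  apply: (@morphism_rigid _ _ (caterpillar s t) (caterpillar s' t')).
  - exact: caterpillar_stc.
  - by move=> x y; rewrite arc.
  - move=> i; have := fl i; rewrite !ffunE /g => <-; by rewrite enum_rankK.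
  - move=> x w xw tw; split; last first.
      move: tw; rewrite /is_tree /is_leaf !degree_cat -(degree_cat s' t').
      by case/orP => /eqP[].
    have : is_ret (caterpillar s t) w = false.
      by move: tw; rewrite /is_tree /is_leaf /is_ret => /orP[]/eqP->.
    move: xw; rewrite ret_cat !darc_cat.
    by case: x w {tw} => [i|[i []]] [j|[j []]].
have E i j : on_spine s' t' j i = on_spine s t j i :> bool.
  case: (leqP (k + k).+2 i) => ik.
    by apply/idP/idP => /on_spine_range; lia.
  have := arc (inl (Ordinal ik)) (inr (j, false)).
  by rewrite !gid !darc_cat.
congr (_, _); apply/permP => j; apply: val_inj.
  have := E (s j).+1 j; rewrite /on_spine eqxx /=.
  by have := ltn_ord (s j); lia.
have := E (k + t j).+1 j; rewrite /on_spine eqxx /=.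
by have := ltn_ord (s j); have := ltn_ord (s' j); lia.
Qed.

Lemma card_network_ge : (k`! * k`! <= #|{: network k.+1}|)%N.
Proof.
rewrite -!card_Sn; have := leq_card _ caterpillar_class_inj.
by rewrite card_prod.
Qed.

End Caterpillar.

(** * Networks with many tree leaves are rare *)

Lemma leq_expl a b e : (a <= b -> a ^ e <= b ^ e)%N.
Proof. by case: e => // e ab; rewrite leq_exp2r. Qed.

Lemma ffact_le_exp m e : (m ^_ e <= m ^ e)%N.
Proof.
elim: e m => [|e IH] m //; rewrite ffactnS expnS leq_mul2l.
by rewrite (leq_trans (IH _)) ?orbT // leq_expl // leq_pred.
Qed.

(** The smallest factor of the falling factorial is m - e + 1, at least [x]. *)
Lemma exp_le_ffact m x e : (x + e <= m.+1 -> x ^ e <= m ^_ e)%N.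
Proof.
elim: e m => [|e IH] m //; case: m => [|m] h.
  have -> : x = 0%N by lia.
  by rewrite exp0n.
rewrite ffactnS expnS /=; apply: leq_mul; first by lia.
by apply: IH; lia.
Qed.

(** A weak Stirling bound: the falling factorial of 2x of length x is a central binomial coefficient
    times x!, and the coefficient is a term of the expansion of (1 + 1)^(2x). *)
Lemma exp_self_le x : (x ^ x <= 4 ^ x * x`!)%N.
Proof.
apply: (@leq_trans ((2 * x) ^_ x)%N); first by apply: exp_le_ffact; lia.
rewrite -bin_ffact leq_mul2r; apply/orP; right.
have -> : (4 ^ x = \sum_(i < (2 * x).+1) 'C(2 * x, i))%N.
  rewrite (_ : 4 = 2 ^ 2)%N // -expnM -[X in (X ^ _)%N]/(1 + 1)%N expnDn.
  by apply: eq_bigr => i _; rewrite !exp1n !muln1.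
have xl : (x < (2 * x).+1)%N by lia.
by rewrite (bigD1 (Ordinal xl)) //= leq_addr.
Qed.

Lemma card_labelled n M : #|labelled n M| = #|networks n 'I_M|.
Proof. by rewrite card_sig; apply: eq_card => N; rewrite !inE. Qed.

(** The size of the vertex set fixes the number of reticulations, hence of arcs; what remains is a
    choice of that many pairs and of a label map. *)
Lemma card_networks_le n (V : finType) k : #|V| = (2 * n + 2 * k)%N ->
  (#|networks n V| <= 'C(#|V| * #|V|, 2 * n + 3 * k - 1) * #|V| ^ n)%N.
Proof.
move=> VE; set e := (2 * n + 3 * k - 1)%N.
have sub : networks n V \subset finset.setX [set A : {set V * V} | #|A| == e]%SET [set: {ffun 'I_n -> V}]%SET.
  apply/fintype.subsetP => N; rewrite !inE andbT => stcN; apply/eqP.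
  by rewrite (card_arcs stcN); have := card_vert stcN; rewrite VE /e; lia.
apply: leq_trans (subset_leq_card sub) _.
by rewrite cardsX card_draws card_prod cardsT card_ffun card_ord.
Qed.

Section SizeBound.
Variables (n k : nat).
Hypotheses (n0 : (0 < n)%N) (kn : (k <= n)%N).
Let M := (2 * n + 2 * k)%N.
Let e := (2 * n + 3 * k - 1)%N.

(** Here [t] stands for the number of isomorphism classes with M vertices. Up to exponential
    factors, M! and e! are M^M and M^e, which leaves t at most M^(n + k - 1), to be compared with
    n^(2n). *)
Lemma size_bound t : (t * M`! <= 'C(M * M, e) * M ^ n)%N ->
  (t * n ^ (n - k) <= 2 ^ (33 * n) * ((n.-1)`! * (n.-1)`!))%N.
Proof.
move=> tM.
have Mp : (0 < M)%N by rewrite /M; lia.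
have b1 : (t * (M`! * e`!) <= M ^ (2 * e + n))%N.
  rewrite mulnA; apply: (@leq_trans ('C(M * M, e) * M ^ n * e`!)%N).
    by rewrite leq_mul2r tM orbT.
  rewrite mulnAC bin_ffact expnD expnM -mulnn leq_mul2r; apply/orP; right.
  exact: ffact_le_exp.
have b2 : (M ^ (e + M) <= 2 ^ (3 * e + 2 * M) * (M`! * e`!))%N.
  have b3 : (M ^ e <= 2 ^ (3 * e) * e`!)%N.
    apply: (@leq_trans ((2 * e) ^ e)%N).
      apply: leq_expl; rewrite /M /e; lia.
    rewrite expnMn (_ : 3 * e = e + 2 * e)%N; last by lia.
    rewrite expnD -mulnA leq_mul2l; apply/orP; right.
    by rewrite expnM; apply: exp_self_le.
  have := leq_mul b3 (exp_self_le M); rewrite -expnD => h; apply: leq_trans h _.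
  rewrite expnD [(2 ^ (2 * M))%N]expnM.
  by rewrite mulnACA [(e`! * _)%N]mulnC.
have b4 : (t <= 2 ^ (3 * e + 2 * M) * M ^ (n + k - 1))%N.
  have Mp' : (0 < M ^ (e + M))%N by rewrite expn_gt0 Mp.
  rewrite -(leq_pmul2r Mp').
  apply: (@leq_trans (t * (2 ^ (3 * e + 2 * M) * (M`! * e`!)))%N).
    by rewrite leq_mul2l b2 orbT.
  rewrite mulnCA -mulnA leq_mul2l; apply/orP; right.
  apply: leq_trans b1 _; rewrite -expnD leq_pexp2l //; rewrite /M /e; lia.
(* The exponents of 2 add up to 3e + 2M + 2(n + k), which is 12n + 15k - 3, at most 27n. *)
have b5 : (t <= 2 ^ (27 * n) * n ^ (n + k))%N.
  apply: leq_trans b4 _.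
  apply: (@leq_trans (2 ^ (3 * e + 2 * M) * (4 * n) ^ (n + k))%N).
    rewrite leq_mul2l; apply/orP; right.
    apply: (@leq_trans (M ^ (n + k))%N); first by rewrite leq_pexp2l //; lia.
    by apply: leq_expl; rewrite /M; lia.
  rewrite expnMn mulnA leq_mul2r; apply/orP; right.
  rewrite (_ : 4 = 2 ^ 2)%N // -expnM -expnD leq_pexp2l //; rewrite /M /e; lia.
(* The factor n between n! and (n - 1)! is absorbed by 2^n. Squared, this costs 6n, which together
   with 27n makes 33n. *)
have b6 : (n ^ n <= 2 ^ (3 * n) * (n.-1)`!)%N.
  apply: leq_trans (exp_self_le n) _.
  rewrite -{2}(prednK n0) factS prednK // mulnA leq_mul2r; apply/orP; right.
  rewrite (_ : 3 * n = 2 * n + n)%N; last by lia.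
  by rewrite expnD expnM leq_mul2l ltnW ?orbT // ltn_expl.
apply: (@leq_trans (2 ^ (27 * n) * n ^ (n + k) * n ^ (n - k))%N).
  by rewrite leq_mul2r b5 orbT.
rewrite -mulnA -expnD (_ : n + k + (n - k) = n + n)%N; last by lia.
rewrite expnD; have := leq_mul b6 b6; rewrite mulnACA -!expnD => h.
rewrite (_ : 33 * n = 27 * n + (3 * n + 3 * n))%N; last by lia.
by rewrite [(2 ^ (27 * n + _))%N]expnD -mulnA leq_mul2l h orbT.
Qed.

End SizeBound.

(** As 4n - M is 2(n - k), the last premise says n <= (n - k)p. Thus n^(n - k) is at least 2^(36n),
    which exceeds the 2^(33n) of [size_bound] by the factor 8^n. *)
Lemma few_with_many_trees n p M : (0 < p)%N -> (2 ^ (36 * p) <= n)%N ->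
  (2 * n <= (4 * n - M) * p)%N ->
  (#|of_size [set: network n]%SET M| * 8 ^ n <= #|{: network n}|)%N.
Proof.
move=> p0 np Mp.
have n0 : (0 < n)%N by apply: leq_trans np; rewrite expn_gt0.
have := card_of_size [set: network n]%SET M.
rewrite (_ : [set N : labelled n M | _]%SET = [set: labelled n M]%SET); last first.
  by apply/setP => N; rewrite !inE.
rewrite cardsT card_labelled; set t := #|of_size _ _| => tE.
(* If the size M occurs at all, any network of that size provides the k with M = 2n + 2k. *)
have [->//|] := posnP t => tp.
have : (0 < #|networks n 'I_M|)%N by rewrite tE muln_gt0 tp fact_gt0.
rewrite card_gt0 => /set0Pn[N]; rewrite inE => stcN.
have ME : #|'I_M| = (2 * n + 2 * nrets N)%N := card_vert stcN.
have kn := nrets_le stcN.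
have := card_networks_le ME; rewrite tE; move: ME kn; move: (nrets N) => k.
rewrite card_ord {N stcN} => ME kn; subst M => tM.
have := size_bound n0 kn tM.
have net : ((n.-1)`! * (n.-1)`! <= #|{: network n}|)%N.
  by case: (n) n0 => // m _; apply: card_network_ge.
move=> h; have h1 : (2 ^ (36 * n) <= n ^ (n - k))%N.
  apply: (@leq_trans ((2 ^ (36 * p)) ^ (n - k))%N).
    rewrite -expnM leq_pexp2l //; move: Mp; nia.
  exact: leq_expl.
have p33 : (0 < 2 ^ (33 * n))%N by rewrite expn_gt0.
rewrite -(leq_pmul2l p33).
apply: (@leq_trans (t * n ^ (n - k))%N); last first.
  by apply: leq_trans h _; rewrite leq_mul2l net orbT.
rewrite mulnCA leq_mul2l; apply/orP; right; apply: leq_trans h1.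
rewrite (_ : 8 = 2 ^ 3)%N // -expnM -expnD leq_pexp2l //; lia.
Qed.

Import Order.TTheory GRing.Theory Num.Theory numFieldNormedType.Exports.
Local Open Scope ring_scope.

(** * Images of the limit networks *)

Section DecorationGraph.
Variables (B : Type) (dec : B -> int -> bool).

(** The reticulation child of [Tr s i]: at position 0 of a side spine it is the reticulation through
    which that spine was introduced. *)
Definition rung (s : spine B) (i : int) : dvertex B :=
  if s is Side s' j then (if i == 0 then Rt s' j else Rt s i) else Rt s i.

Lemma dedge_out s i (y : dvertex B) : dedge (Tr s i) y -> dvertex_exists dec y ->
  y = Tr s (i + 1) \/ y = rung s i.
Proof.
move=> E; inversion E; subst; first by left.
- case: s E => [b|s j] /= _; first by right.
  by case: eqP => [->|]; [rewrite /= andbF|right].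
- by right.
Qed.

Lemma dedge_in (x y : dvertex B) : dedge y x ->
  match x with
  | Tr s i => y = Tr s (i - 1)
  | Rt s i => y = Tr s i \/ y = Tr (Side s i) 0
  | Lf s i => y = Rt s i
  end.
Proof. by case=> *; rewrite ?addrK; auto. Qed.

Lemma rung_edge s i : spine_exists dec s -> (forall b, s = Base b -> dec b i) ->
  dedge (Tr s i) (rung s i) /\ dvertex_exists dec (rung s i).
Proof.
case: s => [b|s j] /= => [_ /(_ b erefl) ->|/andP[se dj] _].
  by split=> //; constructor.
by case: eqP => [->|/eqP i0] /=; rewrite se dj ?i0; split=> //; constructor.
Qed.

Lemma dmark_rung s i : @dmark B (rung s i) = Reticulation.
Proof. by case: s => //= s j; case: ifP. Qed.

Lemma dedge_out_mark (x y z : dvertex B) : dvertex_exists dec y -> dvertex_exists dec z ->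
  dedge x y -> dedge x z -> dmark y = dmark z -> y = z.
Proof.
case: x => s i ey ez.
- move=> /dedge_out/(_ ey)[]-> /dedge_out/(_ ez)[]-> //; rewrite /= dmark_rung //.
- by move=> E1 E2; inversion E1; inversion E2.
- by move=> E1; inversion E1.
Qed.

(* The initial spines are at distance 0 from the root in Lhat, 1 from Rho0 in Rhat. *)
Variable d0 : nat.

Fixpoint spine_depth (s : spine B) : nat :=
  if s is Side s' i then (spine_depth s' + `|i| + 2)%N else d0.

Definition depth (x : dvertex B) : nat :=
  match x with
  | Tr s i => spine_depth s + `|i|
  | Rt s i => spine_depth s + `|i| + 1
  | Lf s i => spine_depth s + `|i| + 2
  end%N.

(** So the depth is bounded on balls, and it measures how far from the centre the image of a vertex
    can lie. *)
Lemma depth_edge x y : dedge x y -> (depth x <= (depth y).+1)%N /\ (depth y <= (depth x).+1)%N.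
Proof. by case=> s i /=; lia. Qed.

End DecorationGraph.

Section Image.
Variables (n : nat) (V : finType) (N : lgraph n V).
Hypothesis stcN : simplex_tree_child N.

(** At a regular tree vertex this is the next vertex of the spine, at a reticulation the leaf below
    it. The default [u] serves only when no such child exists. *)
Definition spine_child (u : V) : V := odflt u [pick d | darc N u d && ~~ is_ret N d].
Definition parent (u : V) : V := odflt u [pick p | darc N p u].
Definition ret_of (u : V) : V := odflt u [pick c | darc N u c && is_ret N c].
Definition partner (u : V) : V := odflt u [pick w | darc N w (ret_of u) && (w != u)].

Lemma spine_childP u : ~~ is_leaf N u -> darc N u (spine_child u) && ~~ is_ret N (spine_child u).
Proof.
move=> /(tree_childP stcN)[w uw tw]; rewrite /spine_child; case: pickP => [//|/(_ w)].
by rewrite uw /=; move: tw; rewrite /is_tree /is_leaf /is_ret => /orP[]/eqP->.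
Qed.

Lemma parentP u : (0 < indeg N u)%N -> darc N (parent u) u.
Proof. by move=> /has_parent[p pu]; rewrite /parent; case: pickP => [//|/(_ p)]; rewrite pu. Qed.

Lemma ret_ofP u : unary N u -> darc N u (ret_of u) && is_ret N (ret_of u).
Proof.
by case/existsP => c /andP[rc uc]; rewrite /ret_of; case: pickP => [//|/(_ c)]; rewrite uc rc.
Qed.

Lemma partnerP u : unary N u -> darc N (partner u) (ret_of u) && (partner u != u).
Proof.
move=> /ret_ofP/andP[uc /eqP[/eqP i2 _]]; rewrite /partner; case: pickP => [//|no].
have [x [y [xy E]]] := elimT (cards2P _) i2.
have /andP[xc yc] : darc N x (ret_of u) && darc N y (ret_of u).
  by move/setP: (E) => /[dup] /(_ x) + /(_ y); rewrite !inE !eqxx orbT => -> ->.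
have := no x; have := no y; rewrite xc yc /= => /negbFE/eqP yu /negbFE/eqP xu.
by rewrite xu yu eqxx in xy.
Qed.

Lemma tree_not_leaf u : is_tree N u -> ~~ is_leaf N u.
Proof. by rewrite /is_leaf => /eqP->. Qed.

Lemma tree_not_ret u : is_tree N u -> ~~ is_ret N u.
Proof. by rewrite /is_ret => /eqP->. Qed.

Lemma regular_tree u : regular N u -> is_tree N u -> unary N u.
Proof.
move=> /or3P[ru /tree_not_ret|//|/existsP[c /andP[rc cu]] /tree_not_leaf].
  by rewrite ru.
by rewrite (ret_child stcN rc cu).
Qed.

(** A regular leaf has a reticulation as its only parent, so a spine cannot end while its vertices
    are regular. *)
Lemma spine_child_tree u : is_tree N u -> regular N (spine_child u) ->
  is_tree N (spine_child u).
Proof.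
move=> tu; have /andP[ud nd] := spine_childP (tree_not_leaf tu).
case/or3P => [rd|/(unary_tree stcN)//|/existsP[c /andP[rc cd]]].
  by rewrite rd in nd.
have /eqP[i1 _] := ret_child stcN rc cd.
by have := tree_not_ret tu; rewrite (indeg1_inj i1 ud cd) rc.
Qed.

Lemma parent_tree u : is_tree N u -> regular N (parent u) -> is_tree N (parent u).
Proof.
move=> tu; have pu : darc N (parent u) u by apply: parentP; case/eqP: tu => ->.
case/or3P => [rp|/(unary_tree stcN)//|/existsP[c /andP[rc cp]]].
  by have := tree_not_leaf tu; rewrite (ret_child stcN rp pu).
by have := leaf_out u (ret_child stcN rc cp); rewrite pu.
Qed.

Lemma partner_tree u : unary N u -> is_tree N (partner u).
Proof.
move=> uu; have /andP[_ rc] := ret_ofP uu; have /andP[pc _] := partnerP uu.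
exact: ret_parent rc pc.
Qed.

(** [Negz k] is -(k + 1), whence the [k.+1] steps to parents. *)
Definition along (u : V) (i : int) : V :=
  match i with Posz k => iter k spine_child u | Negz k => iter k.+1 parent u end.

Let NG := mgraph_of N.

Variables (v : V) (K : nat).
Hypothesis regK : forall w, @gball NG K v w -> regular N w.

Lemma regular_ball k w : (k <= K)%N -> @gball NG k v w -> regular N w.
Proof. by move=> kK wk; apply: regK; apply: gball_mono wk. Qed.

Lemma along_ball d u i : @gball NG d v u -> is_tree N u -> (d + `|i| <= K)%N ->
  @gball NG (d + `|i|) v (along u i) /\ is_tree N (along u i).
Proof.
move=> du tu; case: i => k; rewrite /along /absz.
  elim: k => [|k IH] dk; first by rewrite addn0.
  have [bk tk] := IH ltac:(lia); rewrite addnS.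
  have bS : @gball NG (d + k).+1 v (spine_child (iter k spine_child u)).
    apply: gball_step bk _; left.
    by have /andP[] := spine_childP (tree_not_leaf tk).
  by split=> //; apply: spine_child_tree => //; apply: regular_ball bS; lia.
elim: k.+1 => [|m IH] dk; first by rewrite addn0.
have [bk tk] := IH ltac:(lia); rewrite addnS.
have bS : @gball NG (d + m).+1 v (parent (iter m parent u)).
  by apply: gball_step bk _; right; apply: parentP; case/eqP: tk => ->.
by split=> //; apply: parent_tree => //; apply: regular_ball bS; lia.
Qed.

Variables (B : Type) (base : B -> V) (d0 : nat).
Hypothesis baseP : forall b, @gball NG d0 v (base b) /\ is_tree N (base b).

(** Crossing the reticulation below position [i] leads to its other parent, which becomes position 0
    of the side spine. *)
Fixpoint spine_img (s : spine B) : V :=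
  match s with Base b => base b | Side s' i => partner (along (spine_img s') i) end.

Definition img (x : dvertex B) : V :=
  match x with
  | Tr s i => along (spine_img s) i
  | Rt s i => ret_of (along (spine_img s) i)
  | Lf s i => spine_child (ret_of (along (spine_img s) i))
  end.

Lemma spine_img_ball s : (spine_depth d0 s <= K)%N ->
  @gball NG (spine_depth d0 s) v (spine_img s) /\ is_tree N (spine_img s).
Proof.
elim: s => [b|s IH i] /= sK; first exact: baseP.
have [bs ts] := IH ltac:(lia).
have [|ba ta] := along_ball bs ts (i := i); first by lia.
have ua : unary N (along (spine_img s) i).
  by apply: regular_tree ta; apply: regular_ball ba; lia.
split; last exact: partner_tree.
rewrite addn2; have /andP[uc rc] := ret_ofP ua; have /andP[pc _] := partnerP ua.
have bc := gball_step ba (or_introl _ uc : edge (_ : NG) _ \/ _).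
exact: gball_step bc (or_intror _ pc).
Qed.

Lemma img_tr_ball s i : (depth d0 (Tr s i) <= K)%N ->
  @gball NG (depth d0 (Tr s i)) v (img (Tr s i)) /\ is_tree N (img (Tr s i)).
Proof.
by move=> /= dK; have [|bs ts] := @spine_img_ball s; [lia|exact: along_ball].
Qed.

Lemma img_tr_unary s i : (depth d0 (Tr s i) <= K)%N -> unary N (img (Tr s i)).
Proof.
move=> dK; have [ba ta] := img_tr_ball dK.
by apply: regular_tree ta; apply: regular_ball ba.
Qed.

Lemma img_ball x : (depth d0 x <= K)%N -> @gball NG (depth d0 x) v (img x).
Proof.
case: x => s i dK; first by case: (img_tr_ball dK).
  have dK' : (depth d0 (Tr s i) <= K)%N by move: dK => /=; lia.
  have [bx _] := img_tr_ball dK'.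
  have /andP[uc _] := ret_ofP (img_tr_unary dK').
  by rewrite /= addn1; apply: gball_step bx _; left.
have dK' : (depth d0 (Tr s i) <= K)%N by move: dK => /=; lia.
have [bx _] := img_tr_ball dK'.
have /andP[uc rc] := ret_ofP (img_tr_unary dK').
have /andP[cl _] : darc N (img (Rt s i)) (img (Lf s i)) && ~~ is_ret N (img (Lf s i)).
  by apply: spine_childP; rewrite /is_leaf (eqP rc).
rewrite /= addn2.
have bc := gball_step bx (or_introl _ uc : edge (_ : NG) _ \/ _).
exact: gball_step bc (or_introl _ cl).
Qed.

Lemma img_edge x y : dedge x y -> (depth d0 x <= K)%N -> (depth d0 y <= K)%N ->
  darc N (img x) (img y).
Proof.
case=> s i.
- case: i => k.
    move=> /img_tr_ball[_ tx] _.
    have -> : Posz k + 1 = k.+1 by lia.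
    by have /andP[] := spine_childP (tree_not_leaf tx).
  move=> _ /img_tr_ball[_ ty].
  (* At negative positions the arc comes from the choice of a parent; for k = 0 its head is position
     0. *)
  have -> : img (Tr s (Negz k)) = parent (img (Tr s (Negz k + 1))).
    case: k {ty} => [//|k]; have -> // : Negz k.+1 + 1 = Negz k by lia.
  by apply: parentP; case/eqP: ty => ->.
- by move=> /img_tr_unary/ret_ofP/andP[].
- move=> dK _; have /partnerP/andP[] // : unary N (img (Tr s i)).
  by apply: img_tr_unary; move: dK => /=; lia.
- move=> dK _; have /ret_ofP/andP[_ rc] : unary N (img (Tr s i)).
    by apply: img_tr_unary; move: dK => /=; lia.
  by have /andP[] : darc N (img (Rt s i)) (img (Lf s i)) && ~~ is_ret N (img (Lf s i));
    first by apply: spine_childP; rewrite /is_leaf (eqP rc).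
Qed.

Lemma tree_mark u : is_tree N u -> degree_mark N u = TreeVertex.
Proof. by rewrite /degree_mark /is_leaf /is_ret => /eqP->. Qed.
Lemma ret_mark u : is_ret N u -> degree_mark N u = Reticulation.
Proof. by rewrite /degree_mark /is_leaf /is_ret => /eqP->. Qed.
Lemma leaf_mark u : is_leaf N u -> degree_mark N u = Leaf.
Proof. by rewrite /degree_mark /is_leaf /is_ret => /eqP->. Qed.

Lemma img_mark x : (depth d0 x <= K)%N -> degree_mark N (img x) = dmark x.
Proof.
case: x => s i dK.
- by rewrite tree_mark //; case: (img_tr_ball dK).
- rewrite ret_mark //.
  have /ret_ofP/andP[] // : unary N (img (Tr s i)).
  by apply: img_tr_unary; move: dK => /=; lia.
- rewrite leaf_mark //.
  have dK' : (depth d0 (Tr s i) <= K)%N by move: dK => /=; lia.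
  have /andP[_ rc] := ret_ofP (img_tr_unary dK').
  apply: (ret_child stcN rc).
  by apply: (img_edge (DLeaf s i)) => //; move: dK => /=; lia.
Qed.

(** The separation of the two parents of a reticulation that [covering_iso] requires. *)
Lemma img_partner s i : (depth d0 (Tr s i) <= K)%N ->
  img (Tr (Side s i) 0) <> img (Tr s i).
Proof. by move=> /img_tr_unary/partnerP/andP[_ /eqP]. Qed.

End Image.

Lemma gball_lipschitz (M : mgraph) (a : M) (f : M -> nat) k x :
  (forall x y : M, edge x y -> (f x <= (f y).+1)%N /\ (f y <= (f x).+1)%N) ->
  gball k a x -> (f x <= f a + k)%N.
Proof.
move=> lip; elim: k x => [|k IH] x /=; first by move=> ->; rewrite addn0.
move=> [w /IH wk wx]; rewrite addnS.
by case: wx => [->|/lip[_ H]|/lip[H _]]; lia.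
Qed.

(** * Balls of networks compared with balls of the limits *)

Section Limits.
Variables (n : nat) (V : finType) (N : lgraph n V).
Hypothesis stcN : simplex_tree_child N.
Let NG := mgraph_of N.

(** [covering_iso] for [img] with one base spine through [v]: a point of depth at most r + 1 lands
    within r + 1 of [v], where the network is regular and unentangled. *)
Lemma Lhat_nbhd (r : nat) (v : V) : is_tree N v ->
  (forall w, @gball NG r.+1 v w -> regular N w && ~~ entangled N (2 * r.+1) w) ->
  rooted_iso (nbhd Lhat r) (@nbhd_at NG r v).
Proof.
move=> tv good.
have reg w : @gball NG r.+1 v w -> regular N w by case/good/andP.
have baseP (b : unit) : @gball NG 0 v v /\ is_tree N v by [].
pose im := img N (fun _ : unit => v).
have dpt (x : Lhat_graph) : gball r.+1 (root_of Lhat) x -> (depth 0 (val x) <= r.+1)%N.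
  by apply: (@gball_lipschitz Lhat_graph _ (fun x => depth 0 (val x))) => ? ?; apply: depth_edge.
apply: (@covering_iso n V N stcN Lhat_graph (root_of Lhat) (fun x => im (val x)) r).
- move=> x y /dpt dx /dpt dy xy; exact: (img_edge stcN reg baseP xy).
- by move=> x /dpt dx; apply: (img_mark stcN reg baseP).
- move=> x y z xy xz m; apply: val_inj.
  exact: (dedge_out_mark (valP y) (valP z) xy xz m).
- case=> -[] s i /= ex y z /dedge_in + /dedge_in + // => E1 E2 _; apply: val_inj.
    exact: etrans E1 (esym E2).
  exact: etrans E1 (esym E2).
- by case=> -[].
- case=> -[] // s i ex _.
  have [e3 x3] := @rung_edge unit Lhat_dec s i ex (fun _ _ => erefl).
  exists (exist _ (Tr s (i - 1)) ex), (exist _ (Tr s (i + 1)) ex),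
    (exist (dvertex_exists Lhat_dec) _ x3); split=> //=.
  + by rewrite -{2}(subrK 1 i); constructor.
  + by constructor.
  + exact: dmark_rung.
- case=> -[] // s i ex _.
  have es : spine_exists Lhat_dec s by case/andP: ex.
  exists (exist _ (Tr s i) es), (exist _ (Tr (Side s i) 0) ex), (exist _ (Lf s i) ex).
  split; rewrite /=; try by constructor.
  + by move=> y /dedge_in[] yE; [left|right]; apply: val_inj.
  + move=> /dpt d1 _ /esym; exact: (img_partner stcN reg baseP d1).
- by case=> -[] // s i ex _; exists (exist _ (Rt s i) ex) => /=; constructor.
- move=> x /dpt dx; have /good/andP[_ //] : @gball NG r.+1 v (im (val x)).
  exact: (@gball_mono NG _ _ _ dx _ (img_ball stcN reg baseP dx)).
Qed.

Section TwoSpines.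
Variables (r K : nat) (c : V) (a : Rhat_graph) (p q : V).
Hypothesis rc : is_ret N c.
Hypothesis good : forall w, @gball NG K c w ->
  regular N w && ~~ entangled N (2 * r.+1) w.
Hypotheses (pc : darc N p c) (qc : darc N q c) (pq : p != q).

Definition Rhat_img (x : Rhat_graph) : V :=
  match x with
  | Decorated y => img N (fun b : bool => if b then p else q) (val y)
  | Rho0 => c
  | Ell0 => spine_child N c
  end.

Definition Rhat_depth (x : Rhat_graph) : nat :=
  match x with Decorated y => depth 1 (val y) | Rho0 => 0%N | Ell0 => 1%N end.

Lemma Rhat_edgeE (x y : Rhat_graph) : edge x y ->
  match x, y with
  | Decorated x', Decorated y' => dedge (val x') (val y')
  | Decorated x', Rho0 => exists b, val x' = Tr (Base b) 0
  | Rho0, Ell0 => True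
  | _, _ => False
  end.
Proof. by case=> // b; exists b. Qed.

(** Existence proofs are boolean equalities, so the [erefl] in [RParent] can be replaced by any
    other. *)
Lemma Rhat_parent (x : decoration Rhat_dec) b : val x = Tr (Base b) 0 ->
  Rhat_edge (Decorated x) Rho0.
Proof.
move=> xE; have -> : x = exist _ (Tr (Base b) 0) erefl by apply: val_inj.
exact: RParent.
Qed.

Lemma Rhat_depth_edge (x y : Rhat_graph) : edge x y ->
  (Rhat_depth x <= (Rhat_depth y).+1)%N /\ (Rhat_depth y <= (Rhat_depth x).+1)%N.
Proof.
move=> /Rhat_edgeE; case: x y => [x||] [y||] //=; first exact: depth_edge.
by move=> [b ->].
Qed.

Hypothesis depthP : forall x : Rhat_graph, gball r.+1 a x -> (Rhat_depth x <= K)%N.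
Hypothesis K0 : (0 < K)%N.

(** One argument for both roots: depth is measured from [Rho0] and goodness around [c], while [a]
    may be [Rho0] or [Ell0]; the radius [K] absorbs the difference. *)
Lemma Rhat_nbhd_at : rooted_iso (nbhd_at r a) (@nbhd_at NG r (Rhat_img a)).
Proof.
have reg w : @gball NG K c w -> regular N w by case/good/andP.
have baseP (b : bool) : @gball NG 1 c (if b then p else q) /\
    is_tree N (if b then p else q).
  split; last by case: b; apply: ret_parent rc _.
  by apply: (@gball_step NG _ c) => //; right; case: b.
have /andP[cl _] : darc N c (spine_child N c) && ~~ is_ret N (spine_child N c).
  by apply: spine_childP => //; rewrite /is_leaf (eqP rc).
apply: (@covering_iso n V N stcN Rhat_graph a Rhat_img r).
- move=> x y /depthP + /depthP + /Rhat_edgeE; case: x y => [x||] [y||] //= dx dy.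
    move=> xy; exact: (img_edge stcN reg baseP xy).
  by move=> [b ->] /=; case: b.
- move=> [x||] /depthP /= dx; first exact: (img_mark stcN reg baseP).
    exact: ret_mark.
  by apply: leaf_mark; apply: ret_child cl.
- move=> x y z /Rhat_edgeE xy /Rhat_edgeE xz /=; case: x y z xy xz => [x||] [y||] [z||] //=.
  + move=> xy xz m; congr Decorated; apply: val_inj.
    exact: (dedge_out_mark (valP y) (valP z) xy xz m).
  (* The only other reticulation child would be [Rt (Base b) 0], which does not exist because
     position 0 of a base spine is undecorated. *)
  + move=> xy [b xE]; move: xy; rewrite xE => /dedge_out/(_ (valP y))[-> //|yE].
    by have : dvertex_exists Rhat_dec (sval y) := valP y; rewrite yE.
  + move=> [b xE] xz; move: xz; rewrite xE => /dedge_out/(_ (valP z))[-> //|zE].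
    by have : dvertex_exists Rhat_dec (sval z) := valP z; rewrite zE.
- move=> x y z /Rhat_edgeE yx /Rhat_edgeE zx; case: x y z yx zx => [x||] [y||] [z||] //=.
  case: x => -[] s i /= ex /dedge_in + /dedge_in + // => E1 E2 _; congr Decorated; apply: val_inj.
    exact: etrans E1 (esym E2).
  exact: etrans E1 (esym E2).
- by case=> [[[]]||].
- case=> [x||] //; case: x => -[] // s i ex _.
  (* At position 0 of the two base spines the reticulation child is [Rho0]; everywhere else it is
     the [rung]. *)
  have [[b [sE iE]]|nb] := pselect (exists b, s = Base b /\ i = 0).
    subst; exists (Decorated (exist _ (Tr (Base b) (0 - 1)) ex)),
      (Decorated (exist _ (Tr (Base b) (0 + 1)) ex)), Rho0; split=> //=.
    + by constructor => /=; rewrite -{2}(subrK 1 0); constructor.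
    + by constructor; constructor.
    + exact: (@Rhat_parent _ b).
  have [|e3 x3] := @rung_edge bool Rhat_dec s i ex.
    by move=> b sE; apply/negP => /eqP iE; apply: nb; exists b.
  exists (Decorated (exist _ (Tr s (i - 1)) ex)), (Decorated (exist _ (Tr s (i + 1)) ex)),
    (Decorated (exist (dvertex_exists Rhat_dec) _ x3)); split=> //=.
  + by constructor => /=; rewrite -{2}(subrK 1 i); constructor.
  + by constructor; constructor.
  + by constructor.
  + exact: dmark_rung.
- case=> [x||] //.
    case: x => -[] // s i ex _.
    have es : spine_exists Rhat_dec s by case/andP: ex.
    exists (Decorated (exist _ (Tr s i) es)), (Decorated (exist _ (Tr (Side s i) 0) ex)),
      (Decorated (exist _ (Lf s i) ex)).
    split; try by constructor; constructor.
    + move=> y /Rhat_edgeE; case: y => [y||] //= /dedge_in[] yE; [left|right];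
        by congr Decorated; apply: val_inj.
    + move=> /depthP d1 _ /= /esym; exact: (img_partner stcN reg baseP d1).
  move=> _; exists (Decorated (exist _ (Tr (Base true) 0) erefl)),
    (Decorated (exist _ (Tr (Base false) 0) erefl)), Ell0; split; try by constructor.
  + move=> y /Rhat_edgeE; case: y => [y||] //= [[] yE]; [left|right];
      by congr Decorated; apply: val_inj.
  + by move=> _ _; apply/eqP.
- case=> [x||] //; last by move=> _; exists Rho0; constructor.
  by case: x => -[] // s i ex _; exists (Decorated (exist _ (Rt s i) ex)); constructor; constructor.
- move=> x /depthP dx; have /good/andP[_ //] : @gball NG K c (Rhat_img x).
  move: dx; case: x => [x||] /= dx.
  + exact: (@gball_mono NG _ _ _ dx _ (img_ball stcN reg baseP dx)).
  + by apply: (@gball_mono NG c 0).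
  + apply: (@gball_mono NG c 1) => //; apply: (@gball_step NG _ c) => //; left.
    exact: cl.
Qed.

End TwoSpines.

Lemma ret_parents c : is_ret N c -> exists p q, [/\ darc N p c, darc N q c & p != q].
Proof.
move=> /eqP[/eqP i2 _]; have [p [q [pq E]]] := elimT (cards2P _) i2.
exists p, q; split=> //.
  by move/setP: E => /(_ p); rewrite !inE eqxx.
by move/setP: E => /(_ q); rewrite !inE eqxx orbT.
Qed.

Lemma Rhat_nbhd (r : nat) (c : V) : is_ret N c ->
  (forall w, @gball NG r.+1 c w -> regular N w && ~~ entangled N (2 * r.+1) w) ->
  rooted_iso (nbhd Rhat r) (@nbhd_at NG r c).
Proof.
move=> rc good; have [p [q [pc qc pq]]] := ret_parents rc.
apply: (@Rhat_nbhd_at r r.+1 c Rho0 p q) => // x.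
by move/(gball_lipschitz (f := Rhat_depth)); apply; apply: Rhat_depth_edge.
Qed.

Lemma Nhat_lf_nbhd (r : nat) (c l : V) : is_ret N c -> darc N c l ->
  (forall w, @gball NG r.+3 l w -> regular N w && ~~ entangled N (2 * r.+1) w) ->
  rooted_iso (nbhd Nhat_lf r) (@nbhd_at NG r l).
Proof.
move=> rc cl good; have [p [q [pc qc pq]]] := ret_parents rc.
have -> : l = Rhat_img c p q Ell0.
  have /andP[cl' _] : darc N c (spine_child N c) && ~~ is_ret N (spine_child N c).
    by apply: spine_childP => //; rewrite /is_leaf (eqP rc).
  by case/eqP: rc => _ o1; apply: outdeg1_inj o1 cl cl'.
apply: (@Rhat_nbhd_at r r.+2 c Ell0 p q) => //.
  (* A ball of radius r + 2 about [c] lies in the ball of radius r + 3 about [l], by the step from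
     [l] up to [c]. *)
  move=> w cw; apply: good; elim: r.+2 w cw => [|k IH] w /=.
    by move=> ->; exists l => //; apply: Or33.
  by move=> [w' /IH lw' ww']; exists w'.
move=> x; move/(gball_lipschitz (f := Rhat_depth)); apply; apply: Rhat_depth_edge.
Qed.

End Limits.

(** * Convergence *)

Section Deviation.
Variables (n : nat) (V : finType) (N : lgraph n V).
Hypothesis stcN : simplex_tree_child N.
Let NG := mgraph_of N.

Lemma gball_hood (S : {set V}) l v w : @gball NG l v w -> w \in S ->
  v \in hood (uadj N) l S.
Proof.
elim: l w S => [|l IH] w S /=; first by move=> ->.
move=> [w' lw' ww'] wS; apply: hood_step; apply: IH lw' _.
case: ww' => [<-|arc|arc]; first exact: (fintype.subsetP (thicken_sub _ _)).
  by apply: thickenP wS _; apply/orP; right.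
by apply: thickenP wS _; apply/orP; left.
Qed.

Variables (r : nat) (G : rooted_graph).

Definition defects : {set V} :=
  [set w | ~~ regular N w || entangled N (2 * r.+1) w]%SET.

(** The vertices predicted to match [G] from their type alone; the root is treated as a tree
    vertex. *)
Definition typical : {set V} :=
  [set v | if is_ret N v then `[< rooted_iso (nbhd Rhat r) G >]
           else if is_leaf N v then `[< rooted_iso (nbhd Nhat_lf r) G >]
           else `[< rooted_iso (nbhd Lhat r) G >] ]%SET.

Definition matching : {set V} := [set v | `[< rooted_iso (@nbhd_at NG r v) G >] ]%SET.

(** The radius r + 3 is dictated by the leaves ([Nhat_lf_nbhd]); the other two types need r + 1. *)
Lemma matching_typical v : v \notin hood (uadj N) r.+3 defects ->
  (v \in matching) = (v \in typical).
Proof.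
move=> vD.
have good w : @gball NG r.+3 v w -> regular N w && ~~ entangled N (2 * r.+1) w.
  move=> vw; rewrite -[regular N w]negbK -negb_or; apply: contra vD => wD.
  by apply: gball_hood vw _; rewrite inE.
have good1 w : @gball NG r.+1 v w -> regular N w && ~~ entangled N (2 * r.+1) w.
  by move=> vw; apply: good; apply: gball_mono vw; lia.
have iso (H : rooted_graph) : rooted_iso H (@nbhd_at NG r v) ->
    `[< rooted_iso (@nbhd_at NG r v) G >] = `[< rooted_iso H G >].
  move=> Hv; apply: asbool_equiv_eq; split; first exact: rooted_iso_trans.
  exact: rooted_iso_trans (rooted_iso_sym Hv).
have /andP[rv _] : regular N v && ~~ entangled N (2 * r.+1) v.
  by apply: good; apply: (@gball_mono NG v 0).
rewrite !inE; case: ifP => [rtv|nr]; first by apply: iso; apply: Rhat_nbhd.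
case: ifP => [lv|nl].
  case/or3P: rv => [|/(unary_tree stcN)/eqP tv|/existsP[c /andP[rc cv]]].
  - by rewrite nr.
  - by rewrite /is_leaf tv in lv.
  - by apply: iso; apply: Nhat_lf_nbhd rc cv good.
case/or3P: rv => [|/(unary_tree stcN) tv|/existsP[c /andP[rc cv]]].
- by rewrite nr.
- by apply: iso; apply: Lhat_nbhd.
- by rewrite (ret_child stcN rc cv) in nl.
Qed.

Lemma card_defects :
  (#|hood (uadj N) r.+3 defects| <=
   4 ^ r.+3 * (2 * (n - nrets N) + entanglement (2 * r.+1) N))%N.
Proof.
apply: leq_trans (card_hood _ _ (card_uadj stcN)) _.
rewrite leq_mul2l; apply/orP; right.
have -> : defects = ([set w | ~~ regular N w] :|: [set w | entangled N (2 * r.+1) w])%SET.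
  by apply/setP => w; rewrite !inE.
apply: leq_trans (leq_card_setU _ _) _; rewrite leq_add2r.
by have := card_nonregular stcN; have := nrets_le stcN; lia.
Qed.

(** There are n leaves and k reticulations among 2n + 2k vertices, so n + k vertices, the root among
    them, are of neither type. *)
Lemma card_typical : (#|typical| =
  `[< rooted_iso (nbhd Lhat r) G >] * (n + nrets N)
  + `[< rooted_iso (nbhd Rhat r) G >] * nrets N
  + `[< rooted_iso (nbhd Nhat_lf r) G >] * n)%N.
Proof.
set gL := `[< _ >]; set gR := `[< _ >]; set gF := `[< _ >].
have disj v : is_ret N v -> is_leaf N v = false by rewrite /is_ret /is_leaf => /eqP->.
have -> : (#|typical| = \sum_v (gL * (~~ is_ret N v && ~~ is_leaf N v)
    + gR * is_ret N v + gF * is_leaf N v))%N.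
  rewrite /typical -sum1dep_card big_mkcond; apply: eq_bigr => v _.
  rewrite -/gL -/gR -/gF; have := @disj v.
  case: (is_ret N v) => [->//|_]; first by case: gR; rewrite /= ?muln0 ?muln1.
  by case: (is_leaf N v); [case: gF|case: gL]; rewrite /= ?muln0 ?muln1.
rewrite 2!big_split -!big_distrr /=.
have cnt (P : pred V) : (\sum_v P v = #|P|)%N by rewrite -sum1_card [RHS]big_mkcond.
rewrite !cnt (_ : #|is_ret N| = nrets N); last by rewrite nretsE.
rewrite (_ : #|is_leaf N| = n); last exact: (card_leaves stcN).
congr (_ * _ + _ + _)%N.
have : (#|V| = \sum_v ((~~ is_ret N v && ~~ is_leaf N v) + is_ret N v + is_leaf N v))%N.
  rewrite -sum1_card; apply: eq_bigr => v _; have := @disj v.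
  by case: (is_ret N v) => [->//|_]; case: (is_leaf N v).
rewrite 2!big_split /= !cnt (_ : #|is_ret N| = nrets N); last by rewrite nretsE.
rewrite (_ : #|is_leaf N| = n); last exact: (card_leaves stcN).
rewrite (card_vert stcN) => h; apply: (@addIn (nrets N)); apply: (@addIn n).
by rewrite -h; lia.
Qed.

Lemma matching_deviation (R : realType) :
  `| #|matching|%:R - Nstar_prob R (fun H => rooted_iso (nbhd H r) G) * #|V|%:R |
  <= (4 ^ r.+3 * (2 * (n - nrets N) + entanglement (2 * r.+1) N) + (n - nrets N))%:R :> R.
Proof.
have kn := nrets_le stcN; set k := nrets N in kn *.
have le1 : (#|matching| <= #|typical| + #|hood (uadj N) r.+3 defects|)%N.
  apply: leq_trans (leq_card_setU _ _); apply: subset_leq_card.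
  apply/fintype.subsetP => v vm; rewrite finset.in_setU.
  by case: (boolP (v \in hood _ _ _)) => [|/matching_typical <-]; rewrite ?orbT ?vm.
have le2 : (#|typical| <= #|matching| + #|hood (uadj N) r.+3 defects|)%N.
  apply: leq_trans (leq_card_setU _ _); apply: subset_leq_card.
  apply/fintype.subsetP => v vm; rewrite finset.in_setU.
  by case: (boolP (v \in hood _ _ _)) => [|/matching_typical ->]; rewrite ?orbT ?vm.
have le3 := card_defects; set b := (4 ^ _ * _)%N in le3 *.
have d1 : `| #|matching|%:R - #|typical|%:R | <= b%:R :> R.
  have l1 : #|matching|%:R <= #|typical|%:R + b%:R :> R.
    by rewrite -natrD ler_nat (leq_trans le1) // leq_add2l.
  have l2 : #|typical|%:R <= #|matching|%:R + b%:R :> R.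
    by rewrite -natrD ler_nat (leq_trans le2) // leq_add2l.
  by rewrite ler_norml; apply/andP; split; lra.
(* The weights predict (n + k)/2 reticulations and as many leaves; each count is off by (n -
   k)/2. *)
have d2 : `| #|typical|%:R - Nstar_prob R (fun H => rooted_iso (nbhd H r) G) * #|V|%:R |
    <= (n - k)%:R :> R.
  rewrite card_typical (card_vert stcN) /Nstar_prob /Nstar !big_cons big_nil /=.
  rewrite natrB //; have : (k%:R <= n%:R :> R) by rewrite ler_nat.
  rewrite -/k !(natrD, natrM); move: (n%:R : R) (k%:R : R) => x y yx.
  by do 3 case: (`[< _ >]); rewrite ler_norml /=; apply/andP; split; lra.
rewrite natrD; apply: le_trans (lerD d1 d2); rewrite -[leLHS]/(`|_|).
by apply: le_trans (ler_normD _ _); rewrite addrA subrK.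
Qed.

End Deviation.

(** * Bounding the share of deviating networks *)

Section Rarity.
Variables (n : nat) (R : realType) (r : nat) (G : rooted_graph) (eps : R) (q : nat).
Hypotheses (q0 : (0 < q)%N) (q_eps : q%:R^-1 <= eps).

Let p : R := Nstar_prob R (fun H => rooted_iso (nbhd H r) G).
Let L := (2 * r.+1)%N.
Let c := (q * 4 ^ r.+3)%N.

Definition deviating : {set network n} :=
  [set N : network n | eps < `|nbhd_prop R (repr N) r G - p|]%SET.

(** By [matching_deviation] a deviation is due to a large n - k or to much entanglement, and the
    second premise on [M] rules out the former. *)
Lemma deviating_entangled M (N : labelled n M) : class_of N \in deviating ->
  (0 < n)%N -> ((4 * n - M) * (3 * c) < 2 * n)%N -> (n <= c * entanglement L (val N))%N.
Proof.
rewrite inE (nbhd_prop_iso R r G (repr_class_iso N)) => dev n0 few.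
have stcN : simplex_tree_child (val N) := valP N.
have MV : #|'I_M| = (2 * n + 2 * nrets (val N))%N := card_vert stcN.
have kn := nrets_le stcN.
have M0 : 0 < #|'I_M|%:R :> R by rewrite ltr0n MV; lia.
have := matching_deviation stcN r G R; rewrite -/p => le.
have propE : nbhd_prop R (cnet N) r G = #|matching (val N) r G|%:R / #|'I_M|%:R by [].
move: dev; rewrite propE.
have -> : #|matching (val N) r G|%:R / #|'I_M|%:R - p
  = (#|matching (val N) r G|%:R - p * #|'I_M|%:R) / #|'I_M|%:R.
  by field; rewrite gt_eqF.
rewrite normrM normfV (ger0_norm (ltW M0)) ltr_pdivlMr // => /lt_le_trans/(_ le) lt.
have qM : #|'I_M|%:R <= q%:R * (eps * #|'I_M|%:R).
  have qpos : 0 < q%:R :> R by rewrite ltr0n.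
  have qe : 1 <= q%:R * eps by rewrite -[leLHS](mulfV (lt0r_neq0 qpos)) ler_pM2l.
  by rewrite mulrA; apply: ler_peMl => //; apply: ltW.
have : #|'I_M|%:R < q%:R *
    (4 ^ r.+3 * (2 * (n - nrets (val N)) + entanglement L (val N)) + (n - nrets (val N)))%:R :> R.
  by apply: le_lt_trans qM _; rewrite ltr_pM2l ?ltr0n.
rewrite -natrM ltr_nat MV; move: few; rewrite -[M in (_ - M)%N]card_ord MV /c.
move: (nrets (val N)) (entanglement L (val N)) kn => k x kn few h.
have k4 : (0 < 4 ^ r.+3)%N by rewrite expn_gt0.
move: (4 ^ r.+3)%N k4 few h => t t0 few h.
have kE : (4 * n - (2 * n + 2 * k) = 2 * (n - k))%N by lia.
rewrite kE in few; move: (n - k)%N few h => m few h.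
(* With m = n - k, the terms in m are 2qtm + qm, at most 3cm, hence below n; this explains the
   factor 3 in the hypothesis. *)
have qm : (q * m <= q * t * m)%N by nia.
nia.
Qed.

(** Markov's inequality for the total entanglement, applied to labelled networks; the factor M!
    passes between these and classes. *)
Lemma card_deviating_few M : (2 * 4 ^ L <= n)%N -> (M <= 4 * n)%N -> ((4 * n - M) * (3 * c) < 2 * n)%N ->
  (n * #|of_size deviating M| <= c * (8 * 4 ^ L.+2) * #|of_size [set: network n]%SET M|)%N.
Proof.
move=> Ln M4 few.
have n0 : (0 < n)%N by apply: leq_trans Ln; rewrite muln_gt0 expn_gt0.
have c0 : (0 < c)%N by rewrite /c muln_gt0 q0 expn_gt0.
have M3 : (3 * n <= M)%N by nia.
have f0 : (0 < M`!)%N by exact: fact_gt0.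
rewrite -(leq_pmul2r f0) -[leqLHS]mulnA -[leqRHS]mulnA -!card_of_size.
rewrite (_ : [set N : labelled n M | class_of N \in [set: _]%SET]%SET = [set: labelled n M]%SET);
  last by apply/setP => N; rewrite !inE.
rewrite cardsT card_labelled -(card_imset _ val_inj).
set B := (val @: _)%SET.
have sub : (n * #|B| <= c * \sum_(N in networks n 'I_M) entanglement L N)%N.
  rewrite big_distrr /= mulnC -sum_nat_const big_mkcond [leqRHS]big_mkcond /=.
  apply: leq_sum => N _; case: ifP => // /imsetP[N' + ->]; rewrite inE => NB.
  by rewrite inE (valP N'); apply: deviating_entangled.
apply: leq_trans sub _; rewrite -[leqRHS]mulnA leq_mul2l; apply/orP; right.
have := @sum_entanglement n 'I_M L; rewrite card_ord -big_distrl.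
move: (\sum_(_ in _) _)%N => S; move: #|networks _ _| => T.
rewrite expnS expnS; move: (4 ^ L)%N Ln => x Ln h.
(* Since M is at least 3n and 4^L at most n/2, the number M - 2n - 4^L of available switches is at
   least n/2. *)
have h1 : (S * n <= S * (M - 2 * n - x) * 2)%N by rewrite -mulnA leq_mul2l; lia.
rewrite -(leq_pmul2l n0) mulnC.
apply: leq_trans h1 _; apply: (@leq_trans (T * (M * (4 * (4 * x))) * 2)%N).
  by rewrite leq_mul2r h orbT.
apply: (@leq_trans (T * (4 * n * (4 * (4 * x))) * 2)%N).
  by rewrite leq_mul2r leq_mul2l leq_mul2r M4 !orbT.
by apply: eq_leq; ring.
Qed.

(** All networks of such a size are discarded: the gain 8^n of [few_with_many_trees] outweighs the
    polynomial factor n(4n + 1). *)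
Lemma card_deviating_many M : (2 ^ (36 * (3 * c)) <= n)%N ->
  (2 * n <= (4 * n - M) * (3 * c))%N ->
  (n * (4 * n).+1 * #|of_size deviating M| <= 5 * #|{: network n}|)%N.
Proof.
move=> large many.
have c0 : (0 < 3 * c)%N by rewrite muln_gt0 andTb /c muln_gt0 q0 expn_gt0.
have := few_with_many_trees c0 large many.
have : (#|of_size deviating M| <= #|of_size [set: network n]%SET M|)%N.
  by apply: subset_leq_card; apply/fintype.subsetP => N; rewrite !inE => /andP[_ ->].
have n2 : (n <= 2 ^ n)%N by rewrite ltnW // ltn_expl.
have : (n * (4 * n).+1 <= 5 * 8 ^ n)%N.
  rewrite (_ : 8 ^ n = 2 ^ n * (2 ^ n * 2 ^ n))%N; last by rewrite -!expnMn.
  by move: (2 ^ n)%N n2 => x nx; nia.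
nia.
Qed.

(** Sum over the 4n + 1 possible sizes. Both sides are first multiplied by 4n + 1, so that each size
    in the many-tree regime may contribute 5 times the number of networks. *)
Lemma card_deviating : (2 * 4 ^ L <= n)%N -> (2 ^ (36 * (3 * c)) <= n)%N ->
  (n * #|deviating| <= (c * (8 * 4 ^ L.+2) + 5) * #|{: network n}|)%N.
Proof.
move=> Ln large; rewrite -(leq_pmul2l (ltn0Sn (4 * n))).
rewrite (card_by_size deviating); set D := (c * _)%N.
apply: (@leq_trans (\sum_(M < (4 * n).+1) ((4 * n).+1 * (D * #|of_size [set: network n]%SET M|)
    + 5 * #|{: network n}|))%N).
  rewrite mulnA big_distrr /=; apply: leq_sum => M _.
  case: (leqP (2 * n) ((4 * n - M) * (3 * c))) => hM.
    apply: leq_trans (leq_addl _ _); rewrite [((4 * n).+1 * n)%N]mulnC.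
    exact: card_deviating_many.
  apply: leq_trans (leq_addr _ _); rewrite -mulnA leq_mul2l; apply/orP; right.
  by apply: card_deviating_few => //; rewrite -ltnS.
rewrite big_split /= -!big_distrr /= -card_by_size cardsT sum_nat_const card_ord.
by rewrite mulnDl mulnDr leq_add2l mulnCA.
Qed.

End Rarity.

Theorem corollary1p12 (R : realType) (r : nat) (G : rooted_graph)
    (Gfin : finite_set [set: G]) :
  @cvg_in_uniform_prob R network
    (fun n (N : network n) => nbhd_prop R (repr N) r G)
    (Nstar_prob R (fun H => rooted_iso (nbhd H r) G)).
Proof.
move=> eps eps0.
have [q q0 q_eps] : exists2 q, (0 < q)%N & q%:R^-1 <= eps.
  exists (Num.bound eps^-1).+1 => //; rewrite invf_ple ?posrE ?ltr0n //.
  apply: ltW; apply: lt_le_trans (_ : (Num.bound eps^-1)%:R <= _); last by rewrite ler_nat.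
  by apply: archi_boundP; rewrite invr_ge0 ltW.
pose c := (q * 4 ^ r.+3)%N; pose L := (2 * r.+1)%N.
pose D := (c * (8 * 4 ^ L.+2) + 5)%N.
apply/cvgrPdist_lt => e e0.
(* The deviating share is at most D/n, so n has to exceed D/e besides the two thresholds of
   [card_deviating]. *)
exists (maxn (Num.bound (D%:R / e)).+1 (maxn (2 * 4 ^ L) (2 ^ (36 * (3 * c))))) => // n /=.
rewrite !geq_max => /and3P[nD nL nc].
have dev := @card_deviating n R r G eps q q0 q_eps nL nc.
have n0 : 0 < n%:R :> R by rewrite ltr0n; apply: leq_ltn_trans nD.
rewrite sub0r normrN /uniform_prob.
rewrite ger0_norm; last by rewrite divr_ge0 ?ler0n.
suff : #|@deviating n R r G eps|%:R / #|{: network n}|%:R < e by [].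
(* Division by zero yields zero, which settles the case of an empty set of networks. *)
have [T0|T0] := posnP #|{: network n}|; first by rewrite T0 invr0 mulr0.
rewrite ltr_pdivrMr ?ltr0n // -(ltr_pM2l n0) -natrM.
apply: (@le_lt_trans _ _ (D * #|{: network n}|)%:R); first by rewrite ler_nat.
rewrite natrM mulrA ltr_pM2r ?ltr0n // -ltr_pdivrMr //.
apply: (@lt_le_trans _ _ (Num.bound (D%:R / e))%:R); last by rewrite ler_nat ltnW.
by apply: archi_boundP; rewrite divr_ge0 ?ler0n // ltW.
Qed.
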